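(* Consider an avenue with $N$ cross streets (fluid model, control policies and long-term average queue lengths $\Phi_n,\Psi_n$ as in the context), with identical yellow and orange durations $Y_n=Y$, $O_n=O$ at all nodes and with uniform cross traffic $\lambda_n=\lambda_1=\lambda_{\max}$ for all $n\in\{1,\dots,N\}$. Consider the case $\lambda_0+2\lambda_1\ge 1$, $2\lambda_0+\lambda_1\ge 1$. Let $\Phi_n(\delta),\Psi_n(\delta)$ denote the long-term average queue lengths under the greenwave control policy with parameter $\delta$, for which $$\Phi_1(\delta)=\frac{\lambda_0(1-\lambda_0+\delta\lambda_1)^2(Y+O)^2}{2(1-\lambda_0)(1-\lambda_0-\lambda_1)^2},\qquad \Psi_n(\delta)=\frac{\lambda_1(1+\lambda_0\delta-\lambda_1)^2(Y+O)^2}{2(1-\lambda_1)(1-\lambda_0-\lambda_1)^2},\quad n\in\{1,\dots,N\},$$ and $\Phi_n(\delta)=0$ for $n\ge 2$. Then: (i) Under every control policy satisfying the stability condition, $$\Phi_1\ \ge\ \frac{\lambda_0(1-\lambda_1)^2(Y+O)}{2(1-\lambda_0)(1-\lambda_0-\lambda_1)},\qquad \Psi_n\ \ge\ \frac{\lambda_1(1-\lambda_0)^2(Y+O)}{2(1-\lambda_1)(1-\lambda_0-\lambda_1)},\quad n\in\{1,\dots,N\},$$ and these inequalities are strict unless $G_1=\frac{\lambda_0(Y+O)}{1-\lambda_0-\lambda_1}$ and $R_n=\frac{\lambda_1(Y+O)}{1-\lambda_0-\lambda_1}$, respectively. (ii) As $\delta\downarrow 0$, the values $\Phi_1(\delta)$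 and $\Psi_n(\delta)$, $n\in\{1,\dots,N\}$, approach the absolute lower bounds in (i), respectively. Hence the greenwave control policy is optimal, in the sense that no other control policy can achieve lower values for any $\Phi_n$ or $\Psi_n$ while maintaining stability. (iii) The greenwave control policy is essentially the unique optimal policy in this scenario: optimality forces $G_n=G(0)=\frac{\lambda_0(Y+O)}{1-\lambda_0-\lambda_1}$ and $R_n=R(0)=\frac{\lambda_1(Y+O)}{1-\lambda_0-\lambda_1}$ for all $n\in\{1,\dots,N\}$, and forces the non-green periods to strictly coincide at all the nodes.
   Context: Model. Nodes $1,\dots,N$ lie along an avenue. Avenue traffic arrives at node $1$ as a deterministic fluid at constant rate $\lambda_0$ and must traverse all nodes $1,\dots,N$ in order, leaving after node $N$. Cross traffic arrives at node $n$ as a deterministic fluid at constant rate $\lambda_n$ and leaves after passing node $n$. It is assumed that $\lambda_0+\lambda_n<1$ for all $n$. Write $\lambda_{\max}=\max_{n}\lambda_n$. Lights. At each node $n$ the light runs cyclically through yellow, red, orange, green; each control cycle starts with a yellow period and ends with a green period. The yellow and orange periods have fixed durations $Y_n$, $O_n$. The $k$-th green and red periods have durations $G_n^{(k)}$, $R_n^{(k)}$, chosen by the control policy. ''Non-green'' means yellow, red or orange; ''non-red'' means orange, green or yellow. Avenue fluid can pass node $n$ only when its light is green: at unit rate if avenue fluid is backed up there, otherwise at the inflow rate (the outflow rate of node $n-1$ if $n>1$, or $\lambda_0$ if $n=1$). Cross fluid can pass node $n$ only when its light is red: at unit rate if backed up, otherwise at rate $\lambda_n$. Long-term averages (assumed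 to exist): $G_n=\lim_{K\to\infty}\frac1K\sum_{k=1}^K G_n^{(k)}$, $R_n=\lim_{K\to\infty}\frac1K\sum_{k=1}^K R_n^{(k)}$, and $U_n=G_n+R_n+Y_n+O_n$ is the average cycle length. The stability condition is: $G_n/U_n\ge\lambda_0$ and $R_n/U_n\ge\lambda_n$ for all $n\in\{1,\dots,N\}$. Queues. All queues are empty at time $0$. Let $\overline G_n(b,t)$ and $\overline R_n(b,t)$ be the amounts of non-green and non-red time at node $n$ during $(b,t]$. The avenue and cross queue lengths at node $n$ at time $t$ are $$\Phi_n(t)=\sup_{0\le b\le t}\Big\{\int_b^t\eta_{n-1}(x)\,dx-\big(t-b-\overline G_n(b,t)\big)\Big\},\qquad \Psi_n(t)=\sup_{0\le b\le t}\big\{\overline R_n(b,t)-(1-\lambda_n)(t-b)\big\},$$ where $\eta_0\equiv\lambda_0$ and, for $n\ge1$, $\eta_n(t)$ is the outflow rate of avenue traffic from node $n$: $0$ when node $n$ is non-green, $1$ when node $n$ is green and $\Phi_n(t)>0$, and $\eta_{n-1}(t)$ when node $n$ is green and $\Phi_n(t)=0$. In particular $\Phi_1(t)=\sup_{0\le b\le t}\{\overline G_1(b,t)-(1-\lambda_0)(t-b)\}$. The long-term average queue lengths are $\Phi_n=\limsup_{T\to\infty}\frac1T\int_0^T\Phi_n(t)\,dt$ and $\Psi_n=\limsup_{T\to\infty}\frac1T\int_0^T\Psi_n(t)\,dt$. Greenwave control policy with parameter $\delta\ge 0$ (a small factor; here $Y_n=Y$, $O_n=O$): the states are synchronized across all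 nodes, i.e. all nodes have simultaneous green, orange, red and yellow periods, with common green length $G(\delta)=\frac{\lambda_0(1+\delta)(Y+O)}{1-\lambda_0-\lambda_{\max}}$ and common red length $R(\delta)=\frac{\lambda_{\max}(1+\delta)(Y+O)}{1-\lambda_0-\lambda_{\max}}$.
   Formalization: In (i) the factors (1−λ_1)^2 and (1−λ_0)^2 are interchanged; Φ_1(δ), Ψ_n(δ) are divided by the cycle length (Y+O)(1+δ(λ_0+λ_1))/(1−λ_0−λ_1); in (iii) non-green periods coincide up to a set of times of density zero, and exactly from some time on if the lights are eventually periodic. *)

(* Defs.v *)
From HB Require Import structures.
From mathcomp Require Import all_boot all_order all_algebra.
From mathcomp Require Import all_classical all_reals all_analysis.

Set Implicit Arguments.
Unset Strict Implicit.
Unset Printing Implicit Defensive.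

Import Order.TTheory GRing.Theory Num.Theory.
Import numFieldNormedType.Exports.

Local Open Scope classical_set_scope.
Local Open Scope ring_scope.

(* The nodes are the n with 1 <= n <= nodes A; the values of all the functions
   below at other indices play no role, except that rate A 0 is the arrival rate
   of the avenue traffic (rate A n is that of the cross traffic at node n). *)
Record avenue (R : realType) := Avenue {
  nodes : nat;
  rate : nat -> R;
  yellow_dur : nat -> R;
  orange_dur : nat -> R }.

Definition is_node {R : realType} (A : avenue R) (n : nat) : bool :=
  (1 <= n <= nodes A)%N.

Definition max_rate {R : realType} (A : avenue R) : R :=
  \big[Num.max/rate A 1]_(1 <= n < (nodes A).+1) rate A n.

(* green_dur p n k and red_dur p n k are the durations of the k-th green and red
   periods at node n, for k >= 1. *)
Record policy (R : realType) := Policy {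
  green_dur : nat -> nat -> R;
  red_dur : nat -> nat -> R }.

Definition cycle_average {R : realType} (u : nat -> R) (K : nat) : R :=
  K%:R^-1 * \sum_(1 <= k < K.+1) u k.

Definition mean_green {R : realType} (p : policy R) (n : nat) : R :=
  lim (cycle_average (green_dur p n) @ \oo).

Definition mean_red {R : realType} (p : policy R) (n : nat) : R :=
  lim (cycle_average (red_dur p n) @ \oo).

Definition mean_cycle {R : realType} (A : avenue R) (p : policy R) (n : nat) : R :=
  mean_green p n + mean_red p n + yellow_dur A n + orange_dur A n.

Definition admissible {R : realType} (A : avenue R) (p : policy R) : Prop :=
  forall n, is_node A n ->
    [/\ forall k, (1 <= k)%N -> 0 <= green_dur p n k /\ 0 <= red_dur p n k,
        cvg (cycle_average (green_dur p n) @ \oo) &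
        cvg (cycle_average (red_dur p n) @ \oo)].

Definition stable {R : realType} (A : avenue R) (p : policy R) : Prop :=
  admissible A p /\
  forall n, is_node A n ->
    mean_green p n / mean_cycle A p n >= rate A 0 /\
    mean_red p n / mean_cycle A p n >= rate A n.

(* Start of the k-th cycle at node n (k >= 1); the first one starts at time 0. *)
Definition cycle_start {R : realType} (A : avenue R) (p : policy R)
    (n k : nat) : R :=
  \sum_(1 <= j < k)
    (yellow_dur A n + red_dur p n j + orange_dur A n + green_dur p n j).

Definition yellow_end {R : realType} (A : avenue R) (p : policy R) (n k : nat) : R :=
  cycle_start A p n k + yellow_dur A n.

Definition red_end {R : realType} (A : avenue R) (p : policy R) (n k : nat) : R :=
  yellow_end A p n k + red_dur p n k.

Definition orange_end {R : realType} (A : avenue R) (p : policy R) (n k : nat) : R :=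
  red_end A p n k + orange_dur A n.

Definition yellow {R : realType} (A : avenue R) (p : policy R) (n : nat) : set R :=
  \bigcup_(k in [set k | (1 <= k)%N]) `[cycle_start A p n k, yellow_end A p n k[%classic.

Definition red {R : realType} (A : avenue R) (p : policy R) (n : nat) : set R :=
  \bigcup_(k in [set k | (1 <= k)%N]) `[yellow_end A p n k, red_end A p n k[%classic.

Definition orange {R : realType} (A : avenue R) (p : policy R) (n : nat) : set R :=
  \bigcup_(k in [set k | (1 <= k)%N]) `[red_end A p n k, orange_end A p n k[%classic.

Definition green {R : realType} (A : avenue R) (p : policy R) (n : nat) : set R :=
  \bigcup_(k in [set k | (1 <= k)%N]) `[orange_end A p n k, cycle_start A p n k.+1[%classic.

Definition nongreen {R : realType} (A : avenue R) (p : policy R) (n : nat) : set R :=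
  yellow A p n `|` red A p n `|` orange A p n.

Definition nonred {R : realType} (A : avenue R) (p : policy R) (n : nat) : set R :=
  orange A p n `|` green A p n `|` yellow A p n.

Definition time_in {R : realType} (S : set R) (b t : R) : R :=
  fine (@lebesgue_measure R (S `&` `]b, t])).

(* Avenue queue of a node with the given inflow rate and set S of non-green times. *)
Definition avenue_queue {R : realType} (inflow : R -> R) (S : set R) (t : R) : R :=
  sup [set \int[lebesgue_measure]_(x in `]b, t]) inflow x - (t - b - time_in S b t)
      | b in `[0, t]].

Fixpoint outflow {R : realType} (A : avenue R) (p : policy R) (n : nat) : R -> R :=
  if n is m.+1 then fun t =>
    if t \in nongreen A p n then 0
    else if 0 < avenue_queue (outflow A p m) (nongreen A p n) t then 1
    else outflow A p m t
  else fun=> rate A 0.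

Definition Phi {R : realType} (A : avenue R) (p : policy R) (n : nat) : R -> R :=
  avenue_queue (outflow A p n.-1) (nongreen A p n).

Definition Psi {R : realType} (A : avenue R) (p : policy R) (n : nat) (t : R) : R :=
  sup [set time_in (nonred A p n) b t - (1 - rate A n) * (t - b) | b in `[0, t]].

Definition long_run_average {R : realType} (f : R -> R) : \bar R :=
  limf_esup (fun T : R =>
    ((T^-1)%:E * \int[lebesgue_measure]_(t in `[0%R, T]) (f t)%:E)%E) +oo%R.

Definition mean_Phi {R : realType} (A : avenue R) (p : policy R) (n : nat) : \bar R :=
  long_run_average (Phi A p n).

Definition mean_Psi {R : realType} (A : avenue R) (p : policy R) (n : nat) : \bar R :=
  long_run_average (Psi A p n).

Definition optimal {R : realType} (A : avenue R) (p : policy R) : Prop :=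
  stable A p /\
  forall q, stable A q -> forall n, is_node A n ->
    (mean_Phi A p n <= mean_Phi A q n)%E /\ (mean_Psi A p n <= mean_Psi A q n)%E.

(* Y and O are the common yellow and orange durations; since the durations are the
   same at all nodes and all first cycles start at time 0, the lights are
   synchronized. *)
Definition greenwave_green {R : realType} (A : avenue R) (Y O delta : R) : R :=
  rate A 0 * (1 + delta) * (Y + O) / (1 - rate A 0 - max_rate A).

Definition greenwave_red {R : realType} (A : avenue R) (Y O delta : R) : R :=
  max_rate A * (1 + delta) * (Y + O) / (1 - rate A 0 - max_rate A).

Definition greenwave {R : realType} (A : avenue R) (Y O delta : R) : policy R :=
  Policy (fun _ _ => greenwave_green A Y O delta)
         (fun _ _ => greenwave_red A Y O delta).

(* The non-green periods of nodes n and m coincide up to a set of times of zero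
   density: no finite stretch of cycles affects long-term averages, so exact
   coincidence at all times cannot be forced by them. *)
Definition nongreen_coincide {R : realType} (A : avenue R) (p : policy R)
    (n m : nat) : Prop :=
  (fun T : R =>
     T^-1 * time_in ((nongreen A p n `\` nongreen A p m) `|`
                     (nongreen A p m `\` nongreen A p n)) 0 T)
    @ +oo --> (0 : R).

Definition eventually_periodic {R : realType} (A : avenue R) (p : policy R)
    (T0 P : R) : Prop :=
  forall n, is_node A n -> forall t, T0 <= t ->
    nongreen A p n (t + P) <-> nongreen A p n t.

(* Main.v *)
Require Import Defs.
From HB Require Import structures.
From mathcomp Require Import all_boot all_order all_algebra.
From mathcomp Require Import all_classical all_reals all_analysis.
From mathcomp Require Import measurable_realfun ring lra.

Import Order.TTheory GRing.Theory Num.Theory.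
Import numFieldNormedType.Exports.

Local Open Scope classical_set_scope.
Local Open Scope ring_scope.

Set Implicit Arguments.
Unset Strict Implicit.

(* Each queue is the Skorokhod reflection of its net input.  Over a cycle with blocked
   period B and open period D, the area under a queue fed at constant rate l is at least
   l B^2 / (2 (1 - l)) + (Q_start^2 - Q_end^2) / (2 (1 - l)), because Q^2 / 2 grows at
   rate at least l Q while blocked and decreases at rate at most (1 - l) Q while open.
   The squares telescope, Q(T) = o(T) when the average is finite, and convexity replaces
   the B by their mean beta, so the long-term average is at least
   l beta^2 / (2 (1 - l) U) with U the mean cycle length; under the stability condition
   this is minimal exactly at the greenwave cycle, where it is attained.

   For uniqueness, the optimal green share at every node equals the avenue load, so node 1
   releases fluid at rate 1 during almost all of its green time.  If Phi_2 averages to 0,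
   the amount z of fluid reaching node 2 in a non-green period satisfies
   z^2 / 2 <= (area of Phi_2 over that cycle), so the total of the z is o(T) and the
   non-green sets of the two nodes differ by a set of density 0.  Node 2 then again
   releases at rate 1 during almost all of its green time, and the argument propagates. *)

(** The telescoped squares leave a boundary term [Q (s K) ^+ 2], and [Q T = o(T)] does not make it
    negligible against [K]. It is paid for by letting the horizon run past [s K] by
    [Q (s K) / (1 - lam)]: a queue that decreases at rate at most [1 - lam] covers at least that
    much area while it empties, and the extra time is [o(K)]. The two load assumptions enter the
    minimisation as [rho <= b], once for each type of traffic with the roles of [l0] and [l1]
    exchanged. They give the second factor of the tradeoff identity its sign, so that the shortest
    stable cycle is also the best one. The closed forms are an area per cycle divided by the cycle
    length [(Y + O) * (1 + delta * (l0 + l1)) / (1 - l0 - l1)]; hence a single factor [Y + O] and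
    the factor [1 + delta * (l0 + l1)] below. At [delta = 0] the avenue is blocked for
    [(1 - l0) * (Y + O) / (1 - l0 - l1)] per cycle, hence the [(1 - l0) ^+ 2] in the avenue bound,
    and symmetrically for cross traffic. *)

Section IntervalIntegral.
Context {R : realType}.
Implicit Types (u v : R -> R) (b c t : R).
Local Notation mu := (@lebesgue_measure R).

Definition loc_int u := forall b t, mu.-integrable `]b, t] (EFin \o u).

(** The half-open interval is the one of [time_in] and [avenue_queue]; consecutive intervals are
    disjoint, so splitting has no boundary term. *)
Definition cumul u b t := \int[mu]_(x in `]b, t]) u x.

Lemma loc_int_bounded u M : measurable_fun setT u -> (forall x, `|u x| <= M) -> loc_int u.
Proof.
move=> mu_ uM b t; apply: measurable_bounded_integrable => //=.
- rewrite lebesgue_measure_itv/=; case: ifP => // _.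
  by rewrite -EFinB ltry.
- exact: measurable_funTS.
- exists M; split; first exact: num_real.
  by move=> y My x _; rewrite /= (le_trans (uM x))// ltW.
Qed.

Lemma loc_int_continuous u : continuous u -> loc_int u.
Proof.
move=> cu b t.
apply: (@integrableS _ _ _ mu `[b, t]) => //.
  by apply: subset_itv; rewrite bnd_simp.
apply: continuous_compact_integrable; first exact: segment_compact.
exact: continuous_subspaceT.
Qed.

Lemma loc_intD u v : loc_int u -> loc_int v -> loc_int (fun x => u x + v x).
Proof. by move=> iu iv b t; exact: (integrableD _ (iu b t) (iv b t)). Qed.

Lemma loc_intB u v : loc_int u -> loc_int v -> loc_int (fun x => u x - v x).
Proof. by move=> iu iv b t; exact: (integrableB _ (iu b t) (iv b t)). Qed.

Lemma loc_intZ k u : loc_int u -> loc_int (fun x => k * u x).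
Proof. by move=> iu b t; exact: (integrableZl _ _ (iu b t)). Qed.

Lemma loc_int_cst k : loc_int (fun=> k).
Proof. by apply: (@loc_int_bounded _ `|k|) => // x. Qed.

Lemma loc_int_affine k m s : loc_int (fun x => k + m * (x - s)).
Proof.
apply: loc_int_continuous => x.
apply: cvgD; first exact: cvg_cst.
by apply: cvgM; [exact: cvg_cst|apply: cvgB; [exact: cvg_id|exact: cvg_cst]].
Qed.

Lemma cumul_bb u b : cumul u b b = 0.
Proof. by rewrite /cumul set_itv_ge ?Rintegral_set0// bnd_simp ltxx. Qed.

Lemma cumul_split u c b t : loc_int u -> b <= c -> c <= t ->
  cumul u b t = cumul u b c + cumul u c t.
Proof.
move=> iu bc ct; rewrite /cumul.
rewrite -(@Rintegral_itvB _ u (BRight b) (BRight t) c) ?bnd_simp//.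
by rewrite addrC subrK.
Qed.

Lemma cumulD u v b t : loc_int u -> loc_int v ->
  cumul (fun x => u x + v x) b t = cumul u b t + cumul v b t.
Proof. by move=> iu iv; rewrite /cumul RintegralD. Qed.

Lemma cumulB u v b t : loc_int u -> loc_int v ->
  cumul (fun x => u x - v x) b t = cumul u b t - cumul v b t.
Proof. by move=> iu iv; rewrite /cumul RintegralB. Qed.

Lemma cumulZ k u b t : loc_int u -> cumul (fun x => k * u x) b t = k * cumul u b t.
Proof. by move=> iu; rewrite /cumul RintegralZl. Qed.

(** Dropping the right endpoint lets [cumul_le] and [cumul_eq] ask nothing at switching times, where
    the light has already changed. *)
Lemma cumul_oo u b t : loc_int u -> cumul u b t = \int[mu]_(x in `]b, t[) u x.
Proof.
move=> iu; rewrite /cumul Rintegral_itv_bndo_bndc//.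
by apply: integrableS (iu b t) => //; apply: subset_itv; rewrite bnd_simp.
Qed.

Lemma cumul_le u v b t : loc_int u -> loc_int v ->
  (forall x, b < x < t -> u x <= v x) -> cumul u b t <= cumul v b t.
Proof.
move=> iu iv uv; rewrite !cumul_oo//.
have H w : loc_int w -> mu.-integrable `]b, t[ (EFin \o w).
  move=> iw; apply: integrableS (iw b t) => //.
  by apply: subset_itv; rewrite bnd_simp.
by apply: le_Rintegral => //; exact: H.
Qed.

Lemma cumul_eq u v b t : loc_int u -> loc_int v ->
  (forall x, b < x < t -> u x = v x) -> cumul u b t = cumul v b t.
Proof.
by move=> iu iv uv; apply/eqP; rewrite eq_le !cumul_le// => x /uv ->.
Qed.

Lemma cumul_ge0 u b t : (forall x, b < x <= t -> 0 <= u x) -> 0 <= cumul u b t.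
Proof. by move=> u0; apply: Rintegral_ge0 => x /=; rewrite in_itv; exact: u0. Qed.

Lemma cumul_cst k b t : b <= t -> cumul (fun=> k) b t = k * (t - b).
Proof.
rewrite le_eqVlt => /predU1P[->|bt]; first by rewrite cumul_bb subrr mulr0.
rewrite /cumul Rintegral_cst//= lebesgue_measure_itv/= lte_fin bt//.
Qed.

(** The triangles and trapezoids to which queues are compared all get their area from here. *)
Lemma cumul_affine k m b t : b <= t ->
  cumul (fun x => k + m * (x - b)) b t = k * (t - b) + m * (t - b) ^+ 2 / 2.
Proof.
rewrite le_eqVlt => /predU1P[->|bt]; first by rewrite cumul_bb subrr; lra.
pose F : R -> R := (cst k * (id - cst b)) + (cst (m / 2) * (id - cst b) ^+ 2).
have dF (x : R) : is_derive x 1 F (k + m * (x - b)).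
  have did := is_deriveB (is_derive_id x (1 : R)) (is_derive_cst b x (1 : R)).
  have d1 := is_deriveM (is_derive_cst k x (1 : R)) did.
  have d2 := is_deriveM (is_derive_cst (m / 2) x (1 : R)) (is_deriveX 2 did).
  apply: (is_derive_eq (is_deriveD d1 d2)).
  by rewrite !fctE /GRing.scale /=; lra.
have cF : continuous F.
  by move=> x; apply/differentiable_continuous; rewrite -derivable1_diffP; case: (dF x).
rewrite /cumul Rintegral_itv_obnd_cbnd; last exact: loc_int_affine.
rewrite /Rintegral (continuous_FTC2 (F := F) bt).
- rewrite -EFinB /= /F !fctE /=; lra.
- apply: continuous_subspaceT => x.
  apply: cvgD; first exact: cvg_cst.
  by apply: cvgM; [exact: cvg_cst|apply: cvgB; [exact: cvg_id|exact: cvg_cst]].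
- split.
  + by move=> x _; case: (dF x).
  + by apply: cvg_at_right_filter; exact: cF.
  + by apply: cvg_at_left_filter; exact: cF.
- by move=> x _; rewrite derive1E; exact: derive_val.
Qed.

End IntervalIntegral.

(** * Queues as reflections of their net input *)

Section Reflection.
Context {R : realType}.
Implicit Types (u : R -> R) (b s t : R).

(* Length at time t of a fluid queue with net input rate u, empty at time 0. *)
Definition reflected u t := sup [set cumul u b t | b in `[0, t]].

(** Inflow and service rates lie in [[0, 1]], so net inputs lie in [[-1, 1]]. The bound makes the
    supremum in [reflected] a genuine one and the queue 1-Lipschitz. *)
Definition rate_fun u := loc_int u /\ forall x, `|u x| <= 1.

Lemma rate_fun_loc_int u : rate_fun u -> loc_int u.
Proof. by case. Qed.
Hint Resolve rate_fun_loc_int : core.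

Lemma cumul_le_sub u b t : rate_fun u -> b <= t -> cumul u b t <= t - b.
Proof.
move=> [iu u1] bt; rewrite -[leRHS]mul1r -cumul_cst//.
apply: cumul_le => // [|x _]; first exact: loc_int_cst.
by rewrite (le_trans (ler_norm _)).
Qed.

Lemma cumul_ge_sub u b t : rate_fun u -> b <= t -> - (t - b) <= cumul u b t.
Proof.
move=> [iu u1] bt; rewrite -mulN1r -cumul_cst//.
apply: cumul_le => // [|x _]; first exact: loc_int_cst.
by have := u1 x; rewrite ler_norml => /andP[].
Qed.

Lemma reflected_has_sup u t : rate_fun u -> 0 <= t ->
  has_sup [set cumul u b t | b in `[0, t]].
Proof.
move=> ru t0; split; first by exists (cumul u 0 t), 0 => //=; rewrite in_itv/= lexx.
exists t => _ [b /= + <-]; rewrite in_itv/= => /andP[b0 bt].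
by rewrite (le_trans (cumul_le_sub ru bt))// lerBlDr lerDl.
Qed.

(** For [t < 0] the index set is empty and [sup] takes its default value 0, so a queue is a
    nonnegative continuous function on the whole line. *)
Lemma reflected_neg u t : t <= 0 -> reflected u t = 0.
Proof.
rewrite le_eqVlt => /predU1P[->|t0]; rewrite /reflected.
  by rewrite set_itv1 image_set1 sup1 cumul_bb.
by rewrite set_itv_ge ?bnd_simp -?ltNge// image_set0 sup0.
Qed.

Lemma reflected_ge_cumul u b t : rate_fun u -> 0 <= b <= t -> cumul u b t <= reflected u t.
Proof.
move=> ru /andP[b0 bt]; apply: sup_upper_bound.
  by apply: reflected_has_sup => //; exact: le_trans bt.
by exists b => //=; rewrite in_itv/= b0.
Qed.

Lemma reflected_ge0 u t : rate_fun u -> 0 <= reflected u t.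
Proof.
move=> ru; case: (leP t 0) => [t0|/ltW t0]; first by rewrite reflected_neg.
by rewrite -(cumul_bb u t) reflected_ge_cumul// t0 lexx.
Qed.

Lemma reflected_ge u s t : rate_fun u -> 0 <= s -> s <= t ->
  reflected u s + cumul u s t <= reflected u t.
Proof.
move=> ru s0 st; rewrite -lerBrDr; apply: ge_sup.
  by case: (reflected_has_sup ru s0).
move=> _ [b /= + <-]; rewrite in_itv/= => /andP[b0 bs].
rewrite lerBrDr -cumul_split//; last exact: rate_fun_loc_int.
by apply: reflected_ge_cumul => //; rewrite b0 (le_trans bs).
Qed.

(** The supremum is split at [s]: starting points before [s] contribute at most the queue at [s]
    plus the net input since then. With [reflected_ge], a queue can be followed forward from a known
    value. *)
Lemma reflected_le u s t M : rate_fun u -> 0 <= s -> s <= t ->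
  reflected u s + cumul u s t <= M -> (forall b, s <= b <= t -> cumul u b t <= M) ->
  reflected u t <= M.
Proof.
move=> ru s0 st sM bM; apply: ge_sup.
  by case: (reflected_has_sup ru (le_trans s0 st)).
move=> _ [b /= + <-]; rewrite in_itv/= => /andP[b0 bt].
have [sb|/ltW bs] := leP s b; first by rewrite bM ?sb.
rewrite (cumul_split (c := s))//; last exact: rate_fun_loc_int.
by rewrite (le_trans _ sM)// lerD2r reflected_ge_cumul ?b0.
Qed.

(** Continuity of queues gives their integrability and, later, the measurability of the times at
    which a queue is positive. *)
Lemma reflected_lipschitz u s t : rate_fun u ->
  `|reflected u t - reflected u s| <= `|t - s|.
Proof.
move=> ru; wlog st : s t / s <= t.
  move=> H; have [/H//|/ltW/H] := leP s t.
  by rewrite distrC [in leRHS]distrC.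
rewrite [leRHS]ger0_norm ?subr_ge0//.
have [t0|/ltW t0] := leP t 0.
  by rewrite !reflected_neg ?subrr ?normr0 ?subr_ge0// (le_trans st).
wlog s0 : s st / 0 <= s.
  move=> H; have [/H->//|/ltW s0] := leP 0 s.
  have := H 0 t0 (lexx _); rewrite (reflected_neg u s0) (reflected_neg u (lexx 0)).
  by move=> h; rewrite (le_trans h)// lerB.
rewrite ler_norml; apply/andP; split.
  have := reflected_ge ru s0 st; have := cumul_ge_sub ru st; lra.
rewrite lerBlDr; apply: (reflected_le (s := s)) => //.
  by rewrite addrC lerD2r cumul_le_sub.
move=> b /andP[sb bt]; have := cumul_le_sub ru bt; have := reflected_ge0 s ru; lra.
Qed.

Lemma reflected_continuous u : rate_fun u -> continuous (reflected u).
Proof.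
move=> ru x; apply/cvgrPdist_le => e e0; near=> y.
apply: le_trans (reflected_lipschitz _ _ ru) _.
by near: y; apply: cvgr_dist_le.
Unshelve. all: by end_near. Qed.

Lemma reflected_loc_int u : rate_fun u -> loc_int (reflected u).
Proof. by move=> /reflected_continuous/loc_int_continuous. Qed.

Lemma eq_cumul u v b t : u =1 v -> cumul u b t = cumul v b t.
Proof. by move=> /funext ->. Qed.

Lemma loc_int_indic (S : set R) : measurable S -> loc_int \1_S.
Proof.
move=> mS; apply: (@loc_int_bounded _ _ 1) => [|x].
  exact: measurable_indic.
by rewrite indicE; case: (_ \in _); rewrite ?normr1 ?normr0.
Qed.

Lemma time_inE (S : set R) b t : measurable S -> time_in S b t = cumul \1_S b t.
Proof.
move=> mS; rewrite /time_in /cumul /Rintegral.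
by rewrite integral_indic.
Qed.

(** Unit service outside [S] turns the bracket of the queue formula into one integral; cross queues
    take the same form with a constant inflow. *)
Lemma avenue_queueE (f : R -> R) (S : set R) t : measurable S -> loc_int f ->
  avenue_queue f S t = reflected (fun x => f x - 1 + \1_S x) t.
Proof.
move=> mS If; rewrite /avenue_queue /reflected; congr sup; apply: eq_imagel => b /=.
rewrite in_itv/= => /andP[_ bt].
rewrite cumulD; [|by apply: loc_intB => //; exact: loc_int_cst|exact: loc_int_indic].
rewrite cumulB//; last exact: loc_int_cst.
by rewrite time_inE// cumul_cst// /cumul; lra.
Qed.

Lemma Psi_reflected (A : avenue R) (p : policy R) n t : measurable (nonred A p n) ->
  Psi A p n t = reflected (fun x => rate A n - 1 + \1_(nonred A p n) x) t.
Proof.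
move=> mS; rewrite /Psi /reflected; congr sup; apply: eq_imagel => b /=.
rewrite in_itv/= => /andP[_ bt].
rewrite cumulD; [|exact: loc_int_cst|exact: loc_int_indic].
by rewrite cumul_cst// time_inE//; lra.
Qed.

End Reflection.

(** * Long-run averages and their sampling at cycle starts *)

Section Asymptotics.
Context {R : realType}.
Implicit Types (f Q : R -> R) (s : nat -> R) (C c l U T : R).

Lemma integral_cumul f T : loc_int f ->
  (\int[@lebesgue_measure R]_(t in `[0%R, T]) (f t)%:E)%E = (cumul f 0 T)%:E.
Proof.
move=> If; rewrite /cumul /Rintegral fineK; last first.
  exact: integrable_fin_num (If 0 T).
rewrite integral_itv_obnd_cbnd//.
exact: (measurable_int _ (If 0 T)).
Qed.

(** This and [long_run_average_lt] are the bridge between the extended lim sup and eventual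
    inequalities of reals. *)
Lemma long_run_average_le f c : loc_int f ->
  (\forall T \near +oo, cumul f 0 T <= c * T) -> (long_run_average f <= c%:E)%E.
Proof.
move=> If H.
have [V [VF Vc]] : exists V : set R, (+oo : set_system R) V /\
    (forall T, V T -> 0 < T /\ cumul f 0 T <= c * T).
  exists [set T | 0 < T /\ cumul f 0 T <= c * T]; split => //.
  near=> T; split; first by near: T; apply: nbhs_pinfty_gt; rewrite ?num_real.
  by near: T; exact: H.
rewrite /long_run_average /limf_esup;
  apply: (@le_trans _ _ (ereal_sup [set
  ((T^-1)%:E * \int[lebesgue_measure]_(t in `[0%R, T]) (f t)%:E)%E | T in V])).
  by apply: ereal_inf_lbound; exists V.
apply: ge_ereal_sup => _ [T /Vc[T0 hT] <-].
rewrite integral_cumul// -EFinM lee_fin.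
by rewrite mulrC ler_pdivrMr.
Unshelve. all: by end_near. Qed.

Lemma long_run_average_lt f c : loc_int f -> (long_run_average f < c%:E)%E ->
  \forall T \near +oo, cumul f 0 T <= c * T.
Proof.
move=> If; rewrite /long_run_average /limf_esup => /ereal_inf_lt[_ [V VF <-]] Vc.
near=> T.
have T0 : 0 < T by near: T; apply: nbhs_pinfty_gt; rewrite ?num_real.
have VT : V T by near: T; exact: VF.
rewrite -ler_pdivrMr// mulrC -lee_fin EFinM -integral_cumul//.
apply: (le_trans _ (ltW Vc)).
by apply: ereal_sup_ubound; exists T.
Unshelve. all: by end_near. Qed.

Lemma long_run_average_ge0 f : (forall x, 0 <= f x) -> (0 <= long_run_average f)%E.
Proof.
move=> f0; apply: limf_esup_ge0 => [|T].
  exact: filter_not_empty.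
have [T0|T0] := leP 0 T.
  by rewrite mule_ge0 ?lee_fin ?invr_ge0// integral_ge0// => t _; rewrite lee_fin.
by rewrite set_itv_ge ?bnd_simp -?ltNge// integral_set0 mule0.
Qed.

Lemma cesaro_pinfty s U : 0 < U -> (fun K => K%:R^-1 * s K) @ \oo --> U ->
  s @ \oo --> +oo.
Proof.
move=> U0 sU; apply/cvgryPge => B; near=> K.
have K0 : (0 < K)%N by near: K; exact: nbhs_infty_gt.
have KR : (0 : R) < K%:R by rewrite ltr0n.
have h : U / 2 <= K%:R^-1 * s K.
  by near: K; apply: (cvgr_ge U) => //; rewrite ltr_pdivrMr// ltr_pMr// ltr1n.
have hB : 2 * B / U <= K%:R by near: K; exact: nbhs_infty_ger.
have hs : U / 2 * K%:R <= s K by rewrite mulrC -ler_pdivlMl.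
apply: le_trans hs; move: hB; rewrite ler_pdivrMr//; lra.
Unshelve. all: by end_near. Qed.

(** A queue of height [Q T] falls with slope at most 1, so it sweeps an area of at least
    [Q T ^+ 2 / 2] during []T, T + Q T]]. If [Q T > e * T], this exceeds the linear bound
    [C * (T + Q T)] once [T] is large. *)
Lemma sublinear_of_average Q C : loc_int Q -> (forall t, 0 <= Q t) ->
  (forall x y : R, 0 <= x -> x <= y -> Q x - (y - x) <= Q y) -> 0 <= C ->
  (\forall T \near +oo, cumul Q 0 T <= C * T) ->
  (fun T => T^-1 * Q T) @ +oo --> 0.
Proof.
move=> IQ Q0 QL C0 H; apply/cvgrPdist_le => e e0.
have [T0 [_ HT0]] := H.
(* When [e * T < Q T], the bound [T <= Q T / e] gives [Q T ^+ 2 / 2 <= C * (e^-1 + 1) * Q T], that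
   is [Q T <= M]; taking [T > M / e] excludes this. *)
pose M := 2 * C * (e^-1 + 1).
have M0 : 0 <= M by rewrite /M !mulr_ge0// addr_ge0// invr_ge0 ltW.
near=> T.
have T_gt0 : 0 < T by near: T; apply: nbhs_pinfty_gt; rewrite ?num_real.
have TT0 : T0 < T by near: T; apply: nbhs_pinfty_gt; rewrite ?num_real.
have TM : M / e < T by near: T; apply: nbhs_pinfty_gt; rewrite ?num_real.
rewrite sub0r normrN ger0_norm ?mulr_ge0 ?invr_ge0 ?(ltW T_gt0)//.
rewrite mulrC ler_pdivrMr// leNgt; apply/negP => eTQ.
have h1 : Q T * Q T - Q T ^+ 2 / 2 <= C * (T + Q T).
  have TQ : T0 < T + Q T by rewrite ltr_wpDr.
  apply: le_trans (HT0 _ TQ).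
  rewrite (cumul_split (c := T) IQ (ltW T_gt0)) ?lerDl//.
  apply: ler_wpDl; first exact: cumul_ge0.
  have -> : Q T * Q T - Q T ^+ 2 / 2 =
      Q T * (T + Q T - T) + (- 1) * (T + Q T - T) ^+ 2 / 2 by lra.
  rewrite -cumul_affine; last by rewrite lerDl.
  apply: cumul_le => //; first exact: loc_int_affine.
  move=> x /andP[Tx _]; rewrite mulN1r; apply: QL; exact: ltW.
have QT0 : 0 < Q T by rewrite (le_lt_trans _ eTQ)// mulr_ge0 ?ltW.
have h2 : T <= Q T / e by rewrite ler_pdivlMr// mulrC ltW.
have h3 : Q T * Q T <= M * Q T.
  have : C * T <= C * (Q T / e) by rewrite ler_wpM2l.
  by move: h1; rewrite /M; lra.
rewrite ler_pM2r// in h3.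
move: TM; rewrite ltr_pdivrMr//; lra.
Unshelve. all: by end_near. Qed.

Lemma seq_interval s T : s 0%N = 0 -> {homo s : m n / (m <= n)%N >-> m <= n} ->
  s @ \oo --> +oo -> 0 <= T -> exists K, s K <= T < s K.+1.
Proof.
move=> s0 sm /cvgryPgt/(_ T)[N _ HN] T0.
have ex : exists n, T < s n by exists N; exact: (HN N (leqnn N)).
have := ex_minnP ex => -[[|m]]; first by rewrite s0 => h; move: (lt_le_trans h T0);
  rewrite ltxx.
move=> Tm mn; exists m; rewrite Tm andbT leNgt; apply/negP => /mn.
by rewrite ltnn.
Qed.

Lemma cesaro_shift s l : (fun K => K%:R^-1 * s K) @ \oo --> l ->
  (fun K => K%:R^-1 * s K.+1) @ \oo --> l.
Proof.
move=> sl; have sl1 := sl; rewrite -cvg_shiftS/= in sl1.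
have h : (fun K : nat => (1 + K%:R^-1) * (K.+1%:R^-1 * s K.+1)) @ \oo --> (1 + 0) * l.
  apply: cvgM => //; apply: cvgD; first exact: cvg_cst.
  apply/gtr0_cvgV0; last exact: cvgr_idn.
  by near=> K; rewrite ltr0n; near: K; exact: nbhs_infty_gt.
rewrite addr0 mul1r in h; apply: cvg_trans h; apply: near_eq_cvg.
near=> K.
have K0 : (K%:R : R) != 0 by rewrite pnatr_eq0 -lt0n; near: K; exact: nbhs_infty_gt.
rewrite -[K.+1]addn1 natrD; field; rewrite K0/=.
by rewrite -(natrD _ K 1) addn1 pnatr_eq0.
Unshelve. all: by end_near. Qed.

(** Single cycles need not be bounded, only their averages converge. Monotonicity traps [f T / T]
    between [f (s K) / s K.+1] and [f (s K.+1) / s K] on the cycle of [T], and shifting the index by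
    one does not change a Cesaro limit. *)
Lemma cesaro_interpolation f s U l : s 0%N = 0 ->
  {homo s : m n / (m <= n)%N >-> m <= n} -> 0 < U ->
  (fun K => K%:R^-1 * s K) @ \oo --> U ->
  (forall x y, 0 <= x -> x <= y -> f x <= f y) -> (forall x, 0 <= x -> 0 <= f x) ->
  (fun K => K%:R^-1 * f (s K)) @ \oo --> l ->
  (fun T => T^-1 * f T) @ +oo --> l / U.
Proof.
move=> s0 sm U0 sU fm f0 fl.
have soo := cesaro_pinfty U0 sU.
have s_ge0 K : 0 <= s K by rewrite -s0; exact: sm.
have UNZ : U != 0 by rewrite gt_eqF.
have la : (fun K => (s K)^-1 * f (s K.+1)) @ \oo --> l / U.
  have : (fun K => (K%:R^-1 * s K)^-1 * (K%:R^-1 * f (s K.+1))) @ \oo --> U^-1 * l.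
    by apply: cvgM; [exact: cvgV|exact: (cesaro_shift (s := f \o s))].
  rewrite mulrC; apply: cvg_trans; apply: near_eq_cvg; near=> K.
  have K0 : (K%:R : R) != 0 by rewrite pnatr_eq0 -lt0n; near: K; exact: nbhs_infty_gt.
  have sK : s K != 0 by rewrite gt_eqF//; near: K; move/cvgryPgt : soo; apply.
  by field; rewrite ?K0 ?sK.
have lb : (fun K => (s K.+1)^-1 * f (s K)) @ \oo --> l / U.
  have : (fun K => (K%:R^-1 * s K.+1)^-1 * (K%:R^-1 * f (s K))) @ \oo --> U^-1 * l.
    by apply: cvgM => //; apply: cvgV => //; exact: cesaro_shift.
  rewrite mulrC; apply: cvg_trans; apply: near_eq_cvg; near=> K.
  have K0 : (K%:R : R) != 0 by rewrite pnatr_eq0 -lt0n; near: K; exact: nbhs_infty_gt.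
  have sK : s K.+1 != 0.
    rewrite gt_eqF// (lt_le_trans _ (sm K K.+1 (leqnSn K)))//.
    by near: K; move/cvgryPgt : soo; apply.
  by field; rewrite ?K0 ?sK.
apply/cvgrPdist_le => e e0.
have [N1 _ H1] : \forall K \near \oo, `|l / U - (s K)^-1 * f (s K.+1)| <= e.
  by move/cvgrPdist_le : la; exact.
have [N2 _ H2] : \forall K \near \oo, `|l / U - (s K.+1)^-1 * f (s K)| <= e.
  by move/cvgrPdist_le : lb; exact.
have [N3 _ H3] : \forall K \near \oo, 0 < s K by move/cvgryPgt : soo; exact.
near=> T.
have T0 : 0 <= T by near: T; exact: nbhs_pinfty_ge.
have TN : s (N1 + N2 + N3)%N <= T by near: T; apply: nbhs_pinfty_ge; exact: num_real.
have [K /andP[sKT TsK]] := seq_interval s0 sm soo T0.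
have NK : (N1 + N2 + N3 <= K)%N.
  rewrite leqNgt; apply/negP => /sm h.
  by move: (lt_le_trans TsK (le_trans h TN)); rewrite ltxx.
have N12K : (N1 + N2 <= K)%N := leq_trans (leq_addr _ _) NK.
have sK0 : 0 < s K by apply: H3; exact: leq_trans (leq_addl _ _) NK.
have T_gt0 : 0 < T := lt_le_trans sK0 sKT.
have h1 : `|l / U - (s K)^-1 * f (s K.+1)| <= e by apply: H1;
  exact: leq_trans (leq_addr _ _) N12K.
have h2 : `|l / U - (s K.+1)^-1 * f (s K)| <= e by apply: H2;
  exact: leq_trans (leq_addl _ _) N12K.
have h3 : T^-1 * f T <= (s K)^-1 * f (s K.+1).
  apply: ler_pM; [by rewrite invr_ge0 ltW|exact: f0|by rewrite lef_pV2|].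
  by apply: fm => //; exact: ltW.
have h4 : (s K.+1)^-1 * f (s K) <= T^-1 * f T.
  have sK1 : 0 < s K.+1 := lt_trans T_gt0 TsK.
  apply: ler_pM; [by rewrite invr_ge0 ltW|exact/f0/ltW|by rewrite lef_pV2// ltW|].
  by apply: fm => //; exact: ltW.
move: h1 h2; rewrite !ler_distl => /andP[? ?] /andP[? ?].
apply/andP; split; lra.
Unshelve. all: by end_near. Qed.

Lemma cvg_along (s : nat -> R) (U : R) f (l : R) : 0 < U ->
  (fun K => K%:R^-1 * s K) @ \oo --> U ->
  (fun T => T^-1 * f T) @ +oo --> l ->
  (fun K => K%:R^-1 * f (s K)) @ \oo --> U * l.
Proof.
move=> U0 sU fl; have soo := cesaro_pinfty U0 sU.
have h : (fun K => (K%:R^-1 * s K) * ((s K)^-1 * f (s K))) @ \oo --> U * l.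
  by apply: cvgM => //; exact: (cvg_comp _ _ soo fl).
apply: cvg_trans h; apply: near_eq_cvg; near=> K.
have sK : s K != 0 by rewrite gt_eqF//; near: K; move/cvgryPgt : soo; apply.
by rewrite mulrA -(mulrA K%:R^-1) divff// mulr1.
Unshelve. all: by end_near. Qed.

End Asymptotics.

(** * Alternating blocked and open periods *)

Section AlternatingTimes.
Context {R : realType}.
Variables B D : nat -> R.

(** Cycles are counted from 0 here and from 1 in the model. *)
Definition cyc_start k : R := \sum_(0 <= j < k) (B j + D j).
Definition cyc_mid k : R := cyc_start k + B k.

(* S is the set of blocked times, B k and D k being the lengths of the k-th blocked and
   open periods; a blocked period comes first.  For cross traffic the first blocked
   period is a lone yellow one. *)
Definition alternates (S : set R) :=
  forall k x, (cyc_start k <= x < cyc_mid k -> S x) /\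
              (cyc_mid k <= x < cyc_start k.+1 -> ~ S x).

Lemma cyc_start0 : cyc_start 0 = 0.
Proof. by rewrite /cyc_start big_geq. Qed.

Lemma cyc_startS k : cyc_start k.+1 = cyc_mid k + D k.
Proof. by rewrite /cyc_start big_nat_recr//= addrA. Qed.

Hypothesis B_ge0 : forall k, 0 <= B k.
Hypothesis D_ge0 : forall k, 0 <= D k.

Lemma cyc_start_mid k : cyc_start k <= cyc_mid k.
Proof. by rewrite lerDl. Qed.

Lemma cyc_mid_startS k : cyc_mid k <= cyc_start k.+1.
Proof. by rewrite cyc_startS lerDl. Qed.

Lemma cyc_startSle k : cyc_start k <= cyc_start k.+1.
Proof. exact: le_trans (cyc_start_mid k) (cyc_mid_startS k). Qed.

Lemma cyc_start_homo : {homo cyc_start : m n / (m <= n)%N >-> m <= n}.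
Proof. exact/nondecreasing_seqP/cyc_startSle. Qed.

Lemma cyc_start_ge0 k : 0 <= cyc_start k.
Proof. by rewrite -cyc_start0 cyc_start_homo. Qed.

Lemma cyc_mid_ge0 k : 0 <= cyc_mid k.
Proof. exact: le_trans (cyc_start_ge0 k) (cyc_start_mid k). Qed.

Lemma cyc_start_mean beta delta :
  (fun K => K%:R^-1 * \sum_(0 <= j < K) B j) @ \oo --> beta ->
  (fun K => K%:R^-1 * \sum_(0 <= j < K) D j) @ \oo --> delta ->
  (fun K => K%:R^-1 * cyc_start K) @ \oo --> beta + delta.
Proof.
move=> Bb Dd; under eq_fun do rewrite /cyc_start big_split/= mulrDr.
exact: cvgD.
Qed.

End AlternatingTimes.

(** * Lower bound on the area of a queue, from its slopes alone *)

Section QueueArea.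
Context {R : realType}.
Variables (B D : nat -> R) (lam : R) (Q : R -> R).
Hypothesis B_ge0 : forall k, 0 <= B k.
Hypothesis D_ge0 : forall k, 0 <= D k.
Hypothesis lam_ge0 : 0 <= lam.
Hypothesis lam_lt1 : lam < 1.
Local Notation s := (cyc_start B D).
Local Notation m := (cyc_mid B D).
Hypothesis iQ : loc_int Q.
Hypothesis Q_ge0 : forall t, 0 <= Q t.
Hypothesis Q_drain : forall T t, 0 <= T -> T <= t -> Q T - (1 - lam) * (t - T) <= Q t.
Hypothesis Q_grow : forall k t, s k <= t -> t <= m k -> Q (s k) + lam * (t - s k) <= Q t.

Lemma queue_drain_area_lin T d : 0 <= T -> 0 <= d ->
  Q T * d - (1 - lam) * d ^+ 2 / 2 <= cumul Q T (T + d).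
Proof.
have hl0 := lam_ge0; have hl1 := lam_lt1.
move=> T0 d0; have Td : T <= T + d by rewrite lerDl.
have -> : Q T * d - (1 - lam) * d ^+ 2 / 2 =
  cumul (fun x => Q T + (lam - 1) * (x - T)) T (T + d) by rewrite cumul_affine//; lra.
apply: cumul_le => //; first exact: loc_int_affine.
move=> x /andP[Tx _]; have := Q_drain T0 (ltW Tx); lra.
Qed.

(** The length [Q T / (1 - lam)] is the shortest time in which the queue can empty, so the full
    triangle lies below it. *)
Lemma queue_drain_area T : 0 <= T ->
  Q T ^+ 2 / (2 * (1 - lam)) <= cumul Q T (T + Q T / (1 - lam)).
Proof.
have hl0 := lam_ge0; have hl1 := lam_lt1.
move=> T0; have l0 : 0 < 1 - lam by lra.
have QT0 : 0 <= Q T by [].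
apply: le_trans (queue_drain_area_lin T0 _); last by rewrite divr_ge0// ltW.
by rewrite le_eqVlt; apply/orP; left; apply/eqP; field; rewrite gt_eqF.
Qed.

(** If the queue has time to empty within [d], the whole triangle fits. Otherwise the trapezoid over
    [d] ends at the positive height [Q T - (1 - lam) * d], which is at most [Q (T + d)], and
    squaring is monotone there. *)
Lemma queue_drain_area_sub T d : 0 <= T -> 0 <= d ->
  (Q T ^+ 2 - Q (T + d) ^+ 2) / (2 * (1 - lam)) <= cumul Q T (T + d).
Proof.
have hl0 := lam_ge0; have hl1 := lam_lt1.
move=> T0 d0; have l0 : 0 < 1 - lam by lra.
have QT0 : 0 <= Q T by [].
have QTd0 : 0 <= Q (T + d) by [].
have Td : T <= T + d by rewrite lerDl.
have [h|h] := leP (Q T / (1 - lam)) d.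
  apply: (@le_trans _ _ (Q T ^+ 2 / (2 * (1 - lam)))).
    by rewrite ler_pM2r ?invr_gt0 ?mulr_gt0// gerBl sqr_ge0.
  apply: (le_trans (queue_drain_area T0)).
  have h1 : T <= T + Q T / (1 - lam) by rewrite lerDl divr_ge0// ltW.
  have h2 : T + Q T / (1 - lam) <= T + d by rewrite lerD2l.
  rewrite (cumul_split (c := T + Q T / (1 - lam)) iQ h1 h2) lerDl.
  by apply: cumul_ge0 => x _; exact: Q_ge0.
apply: le_trans (queue_drain_area_lin T0 d0).
have hQ : Q T - (1 - lam) * d <= Q (T + d).
  by have := Q_drain T0 Td; have -> : T + d - T = d by lra.
rewrite ltr_pdivlMr// in h.
rewrite ler_pdivrMr ?mulr_gt0//.
have : (Q T - (1 - lam) * d) ^+ 2 <= Q (T + d) ^+ 2.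
  rewrite ler_pXn2r ?nnegrE//; lra.
lra.
Qed.

(** The blocked part [lam * B ^+ 2 / 2] and the draining part [(lam * B) ^+ 2 / (2 * (1 - lam))] add
    up to the stated term. The cross terms in [Q (s k) * B k] are nonnegative and dropped. *)
Lemma queue_cycle_area k :
  lam * B k ^+ 2 / (2 * (1 - lam)) +
    (Q (s k) ^+ 2 - Q (s k.+1) ^+ 2) / (2 * (1 - lam)) <= cumul Q (s k) (s k.+1).
Proof.
have hl0 := lam_ge0; have hl1 := lam_lt1.
have l0 : 0 < 1 - lam by lra.
have sk0 := cyc_start_ge0 B_ge0 D_ge0 k.
have mk0 := cyc_mid_ge0 B_ge0 D_ge0 k.
have sm : s k <= m k by exact: cyc_start_mid.
have ms : m k <= s k.+1 by exact: cyc_mid_startS.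
rewrite (cumul_split (c := m k) iQ sm ms) cyc_startS.
have Q0 : 0 <= Q (s k) by [].
have hB : Q (s k) * B k + lam * B k ^+ 2 / 2 <= cumul Q (s k) (m k).
  have -> : Q (s k) * B k + lam * B k ^+ 2 / 2 =
      cumul (fun x => Q (s k) + lam * (x - s k)) (s k) (m k).
    by rewrite cumul_affine// /cyc_mid; lra.
  apply: cumul_le => //; first exact: loc_int_affine.
  move=> x /andP[/ltW kx /ltW xk].
  exact: Q_grow.
have hD := queue_drain_area_sub mk0 (D_ge0 k).
have hP : Q (s k) + lam * B k <= Q (m k).
  apply: le_trans (Q_grow (k := k) sm (lexx _)).
  by rewrite /cyc_mid; lra.
have hP2 : (Q (s k) + lam * B k) ^+ 2 <= Q (m k) ^+ 2.
  have h0 : 0 <= Q (s k) + lam * B k by rewrite addr_ge0// mulr_ge0.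
  by rewrite ler_pXn2r// nnegrE//; exact: le_trans hP.
apply: le_trans (lerD hB hD).
rewrite -mulrDl ler_pdivrMr ?mulr_gt0// mulrDl divfK ?mulf_neq0 ?gt_eqF//.
have : 0 <= Q (s k) * B k by rewrite mulr_ge0.
lra.
Qed.

Lemma queue_area K :
  lam / (2 * (1 - lam)) * \sum_(0 <= j < K) B j ^+ 2 <=
  cumul Q 0 (s K) + Q (s K) ^+ 2 / (2 * (1 - lam)).
Proof.
have hl0 := lam_ge0; have hl1 := lam_lt1.
elim: K => [|K IH].
  rewrite big_geq// mulr0 cyc_start0 cumul_bb add0r.
  by rewrite divr_ge0 ?sqr_ge0// mulr_ge0//; lra.
have sK0 := cyc_start_ge0 B_ge0 D_ge0 K.
rewrite (cumul_split (c := s K) iQ sK0); last exact: cyc_startSle.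
rewrite big_nat_recr//= mulrDr.
have := queue_cycle_area K; lra.
Qed.

(** The boundary square of [queue_area] is absorbed by the triangle that follows [s K], at the price
    of a horizon longer by a multiple of [Q (s K)]. *)
Lemma queue_area_tail K :
  lam / (2 * (1 - lam)) * \sum_(0 <= j < K) B j ^+ 2 <=
  cumul Q 0 (s K + Q (s K) / (1 - lam)).
Proof.
have hl0 := lam_ge0; have hl1 := lam_lt1.
have sK0 := cyc_start_ge0 B_ge0 D_ge0 K.
have l0 : 0 < 1 - lam by lra.
have h : s K <= s K + Q (s K) / (1 - lam).
  by rewrite lerDl divr_ge0 ?Q_ge0// ltW.
rewrite (cumul_split (c := s K) iQ sK0 h).
apply: le_trans (queue_area K) _; rewrite lerD2l.
exact: queue_drain_area.
Qed.

Lemma queue_sublinear C : 0 <= C -> (\forall T \near +oo, cumul Q 0 T <= C * T) ->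
  (fun T => T^-1 * Q T) @ +oo --> 0.
Proof.
apply: sublinear_of_average => // x y x0 xy.
apply: le_trans (Q_drain x0 xy); rewrite lerD2l lerN2 ler_piMl ?subr_ge0//.
by rewrite gerBl.
Qed.

(** An average below the bound is finite and makes the queue sublinear; the horizon of
    [queue_area_tail] is then asymptotic to [s K], and dividing by [K] gives a contradiction. *)
Lemma queue_average_ge beta delta :
  (fun K => K%:R^-1 * \sum_(0 <= j < K) B j) @ \oo --> beta ->
  (fun K => K%:R^-1 * \sum_(0 <= j < K) D j) @ \oo --> delta ->
  0 < beta + delta ->
  ((lam * beta ^+ 2 / (2 * (1 - lam) * (beta + delta)))%:E <= long_run_average Q)%E.
Proof.
have hl0 := lam_ge0; have hl1 := lam_lt1.
move=> Bb Dd U0; set c := (X in X%:E); rewrite leNgt; apply/negP => hc.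
have l0 : 0 < 1 - lam by lra.
have LR0 : (0 <= long_run_average Q)%E.
  by apply: long_run_average_ge0 => x; exact: Q_ge0.
have [r rE] : exists r, long_run_average Q = r%:E.
  exists (fine (long_run_average Q)); rewrite fineK//.
  by rewrite ge0_fin_numE// (lt_trans hc)// ltry.
rewrite rE lte_fin in hc; rewrite rE lee_fin in LR0.
(* The midpoint leaves a strict gap on both sides: above the average for [long_run_average_lt],
   below [c] for the contradiction. *)
pose c' := (r + c) / 2.
have c'0 : 0 <= c' by rewrite /c'; lra.
have c'c : c' < c by rewrite /c'; lra.
have hc' : \forall T \near +oo, cumul Q 0 T <= c' * T.
  by apply: long_run_average_lt => //; rewrite rE lte_fin /c'; lra.
have Qo := queue_sublinear c'0 hc'.
have sU := cyc_start_mean Bb Dd.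
have soo := cesaro_pinfty U0 sU.
have Qs := cvg_along U0 sU Qo; rewrite mulr0 in Qs.
(* The averages of [B j ^+ 2] need not converge, so each square is replaced by its tangent
   [2 * beta * B j - beta ^+ 2] at [beta], whose averages do. *)
have lhs : (fun K => lam / (2 * (1 - lam)) *
    (2 * beta * (K%:R^-1 * \sum_(0 <= j < K) B j) - beta ^+ 2)) @ \oo -->
    lam / (2 * (1 - lam)) * (2 * beta * beta - beta ^+ 2).
  apply: cvgM; first exact: cvg_cst.
  apply: cvgB; last exact: cvg_cst.
  by apply: cvgM => //; exact: cvg_cst.
have rhs : (fun K => c' * (K%:R^-1 * s K + (K%:R^-1 * Q (s K)) * (1 - lam)^-1)) @ \oo -->
    c' * (beta + delta + 0 * (1 - lam)^-1).
  apply: cvgM; first exact: cvg_cst.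
  by apply: cvgD => //; apply: cvgM => //; exact: cvg_cst.
have : lam / (2 * (1 - lam)) * (2 * beta * beta - beta ^+ 2) <=
       c' * (beta + delta + 0 * (1 - lam)^-1).
  have [T0 [_ HT0]] := hc'.
  apply: (ler_cvg_to lhs rhs); near=> K.
  have K0 : (0 : R) < K%:R by rewrite ltr0n; near: K; exact: nbhs_infty_gt.
  have hT : cumul Q 0 (s K + Q (s K) / (1 - lam)) <= c' * (s K + Q (s K) / (1 - lam)).
    apply: HT0.
    apply: (@lt_le_trans _ _ (s K)); first by near: K; move/cvgryPgt : soo => /(_ T0);
      exact.
    by rewrite lerDl divr_ge0 ?Q_ge0// ltW.
  have h := le_trans (queue_area_tail K) hT.
  have hB : 2 * beta * (\sum_(0 <= j < K) B j) - K%:R * beta ^+ 2 <= \sum_(0 <=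
    j < K) B j ^+ 2.
    have -> : K%:R * beta ^+ 2 = \sum_(0 <= j < K) beta ^+ 2.
      by rewrite sumr_const_nat subn0 mulr_natl.
    rewrite mulr_sumr -sumrB; apply: ler_sum => j _.
    by rewrite -subr_ge0; have := sqr_ge0 (B j - beta); lra.
  have h2 : lam / (2 * (1 - lam)) * (2 * beta * (\sum_(0 <= j < K) B j) - K%:R * beta ^+ 2)
     <= c' * (s K + Q (s K) / (1 - lam)).
    by apply: le_trans h; rewrite ler_wpM2l// divr_ge0// mulr_ge0// ltW.
  rewrite -(ler_pM2l K0); apply: le_trans (le_trans h2 _);
    rewrite le_eqVlt; apply/orP; left; apply/eqP.
    by field; rewrite !gt_eqF.
  by field; rewrite !gt_eqF.
rewrite mul0r addr0 -ler_pdivrMr// => h.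
have : c <= c'.
  apply: le_trans h; rewrite le_eqVlt; apply/orP; left; apply/eqP.
  by rewrite /c; field; rewrite !gt_eqF.
lra.
Unshelve. all: by end_near. Qed.

End QueueArea.

(** * A queue fed at constant rate *)

Section SingleQueue.
Context {R : realType}.
Variables (B D : nat -> R) (S : set R) (lam : R).
Hypothesis B_ge0 : forall k, 0 <= B k.
Hypothesis D_ge0 : forall k, 0 <= D k.
Hypothesis mS : measurable S.
Hypothesis altS : alternates B D S.
Hypothesis lam_ge0 : 0 <= lam.
Hypothesis lam_lt1 : lam < 1.

Let u (x : R) : R := lam - 1 + \1_S x.
Let Q := reflected u.
Local Notation s := (cyc_start B D).
Local Notation m := (cyc_mid B D).

Lemma single_rate_fun : rate_fun u.
Proof.
have hl0 := lam_ge0; have hl1 := lam_lt1.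
split; first by apply: loc_intD; [exact: loc_int_cst|exact: loc_int_indic].
move=> x; rewrite /u indicE ler_norml.
by case: (x \in S); rewrite ?mulr1n ?mulr0n; apply/andP; split; lra.
Qed.
Let ru := single_rate_fun.
Let iQ : loc_int Q := reflected_loc_int ru.

Lemma single_cumul_blocked k b t : s k <= b -> b <= t -> t <= m k ->
  cumul u b t = lam * (t - b).
Proof.
have hl0 := lam_ge0; have hl1 := lam_lt1.
move=> kb bt tk; rewrite -cumul_cst//; apply: cumul_eq => //;
  [by case: ru|exact: loc_int_cst|].
move=> x /andP[bx xt]; rewrite /u indicE mem_set ?subrK//.
apply: (proj1 (altS k x)); lra.
Qed.

Lemma single_cumul_open k b t : m k <= b -> b <= t -> t <= s k.+1 ->
  cumul u b t = - ((1 - lam) * (t - b)).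
Proof.
have hl0 := lam_ge0; have hl1 := lam_lt1.
move=> kb bt tk; rewrite -mulNr opprB -cumul_cst//; apply: cumul_eq => //;
  [by case: ru|exact: loc_int_cst|].
move=> x /andP[bx xt]; rewrite /u indicE memNset ?addr0//.
apply: (proj2 (altS k x)); lra.
Qed.

Lemma single_drain T t : 0 <= T -> T <= t -> Q T - (1 - lam) * (t - T) <= Q t.
Proof.
move=> T0 Tt; apply: le_trans (reflected_ge ru T0 Tt); rewrite lerD2l.
rewrite -mulNr opprB -cumul_cst//; apply: cumul_le; [exact: loc_int_cst|by case: ru|].
by move=> x _; rewrite /u lerDl indicE.
Qed.

Lemma single_grow k t : s k <= t -> t <= m k -> Q (s k) + lam * (t - s k) <= Q t.
Proof.
move=> kt tk; rewrite -(single_cumul_blocked (k := k))//.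
by apply: reflected_ge => //; exact: cyc_start_ge0.
Qed.

Lemma single_sublinear C : 0 <= C -> (\forall T \near +oo, cumul Q 0 T <= C * T) ->
  (fun T => T^-1 * Q T) @ +oo --> 0.
Proof.
apply: (queue_sublinear lam_ge0 iQ _ single_drain).
by move=> t; exact: reflected_ge0.
Qed.

Lemma single_average_ge beta delta :
  (fun K => K%:R^-1 * \sum_(0 <= j < K) B j) @ \oo --> beta ->
  (fun K => K%:R^-1 * \sum_(0 <= j < K) D j) @ \oo --> delta ->
  0 < beta + delta ->
  ((lam * beta ^+ 2 / (2 * (1 - lam) * (beta + delta)))%:E <= long_run_average Q)%E.
Proof.
apply: (queue_average_ge B_ge0 D_ge0 lam_ge0 lam_lt1 iQ _ single_drain single_grow).
by move=> t; exact: reflected_ge0.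
Qed.

End SingleQueue.

(** * Matching upper bound when every open period empties the queue *)

Section SingleQueueUpper.
Context {R : realType}.
Variables (B D : nat -> R) (S : set R) (lam : R).
Hypothesis B_ge0 : forall k, 0 <= B k.
Hypothesis D_ge0 : forall k, 0 <= D k.
Hypothesis mS : measurable S.
Hypothesis altS : alternates B D S.
Hypothesis lam_ge0 : 0 <= lam.
Hypothesis lam_lt1 : lam < 1.

Let u (x : R) : R := lam - 1 + \1_S x.
Let Q := reflected u.
Local Notation s := (cyc_start B D).
Local Notation m := (cyc_mid B D).

Let ru : rate_fun u := single_rate_fun mS lam_ge0 lam_lt1.
Let iQ : loc_int Q := reflected_loc_int ru.

(* If every open period is long enough to empty the queue, the queue is a
   triangle on each cycle. *)
Hypothesis drained : forall k, lam * B k <= (1 - lam) * D k.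

Lemma drained_blocked_le k t : Q (s k) <= 0 -> s k <= t -> t <= m k ->
  Q t <= lam * (t - s k).
Proof.
have hl0 := lam_ge0 => Q0 kt tk.
have sk0 := cyc_start_ge0 B_ge0 D_ge0 k.
apply: (reflected_le ru sk0 kt).
  rewrite (single_cumul_blocked mS altS lam_ge0 lam_lt1 (k := k))// -/Q; lra.
move=> b /andP[kb bt]; rewrite (single_cumul_blocked mS altS lam_ge0 lam_lt1 (k := k))//.
by rewrite ler_wpM2l// lerB.
Qed.

(** Busy periods that began before [m k] give the line of slope [-(1 - lam)] from height at most
    [lam * B k]; starting points after [m k] see only drainage and give at most 0. *)
Lemma drained_open_le k t : Q (s k) <= 0 -> m k <= t -> t <= s k.+1 ->
  Q t <= Num.max 0 (lam * B k - (1 - lam) * (t - m k)).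
Proof.
have hl1 := lam_lt1 => Q0 kt tk.
have l0 : 0 < 1 - lam by lra.
have mk0 := cyc_mid_ge0 B_ge0 D_ge0 k.
apply: (reflected_le ru mk0 kt).
  rewrite (single_cumul_open mS altS lam_ge0 lam_lt1 (k := k))// -/Q.
  rewrite le_max; apply/orP; right; rewrite lerD2r.
  have := drained_blocked_le Q0 (cyc_start_mid D B_ge0 k) (lexx _).
  by have -> : m k - s k = B k by rewrite /cyc_mid; lra.
move=> b /andP[kb bt]; rewrite (single_cumul_open mS altS lam_ge0 lam_lt1 (k := k))//.
by rewrite le_max oppr_le0 mulr_ge0 ?subr_ge0// ltW.
Qed.

Lemma drained_start k : Q (s k) <= 0.
Proof.
have hl0 := lam_ge0; have hl1 := lam_lt1.
elim: k => [|k IH]; first by rewrite cyc_start0 /Q reflected_neg.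
apply: (le_trans (drained_open_le IH (cyc_mid_startS B D_ge0 k) (lexx _))).
rewrite ge_max lexx/=.
have -> : s k.+1 - m k = D k by rewrite cyc_startS; lra.
by rewrite subr_le0.
Qed.

Lemma drained_cycle_area k :
  cumul Q (s k) (s k.+1) <= lam * B k ^+ 2 / (2 * (1 - lam)).
Proof.
have hl0 := lam_ge0; have hl1 := lam_lt1.
have l0 : 0 < 1 - lam by lra.
have Q0 := drained_start k.
have sm : s k <= m k by exact: cyc_start_mid.
have ms : m k <= s k.+1 by exact: cyc_mid_startS.
(* The latest time at which the queue of this cycle is gone; [drained] puts it before the next
   cycle. *)
pose r := m k + lam * B k / (1 - lam).
have lB : 0 <= lam * B k by rewrite mulr_ge0.
have mr : m k <= r by rewrite lerDl divr_ge0// ltW.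
have rs : r <= s k.+1.
  by rewrite /r cyc_startS lerD2l ler_pdivrMr// [leRHS]mulrC drained.
rewrite (cumul_split (c := m k) iQ sm ms) (cumul_split (c := r) iQ mr rs).
have h1 : cumul Q (s k) (m k) <= lam * B k ^+ 2 / 2.
  have -> : lam * B k ^+ 2 / 2 = cumul (fun x => 0 + lam * (x - s k)) (s k) (m k).
    by rewrite cumul_affine// /cyc_mid; lra.
  apply: cumul_le => //; first exact: loc_int_affine.
  by move=> x /andP[/ltW kx /ltW xk]; rewrite add0r; exact: drained_blocked_le.
have h2 : cumul Q (m k) r <= (lam * B k) ^+ 2 / (2 * (1 - lam)).
  have -> : (lam * B k) ^+ 2 / (2 * (1 - lam)) =
      cumul (fun x => lam * B k + (lam - 1) * (x - m k)) (m k) r.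
    by rewrite cumul_affine// /r; field; rewrite gt_eqF.
  apply: cumul_le => //; first exact: loc_int_affine.
  move=> x /andP[kx xk]; apply: (le_trans (drained_open_le Q0 (ltW kx) _)).
    exact: le_trans (ltW xk) rs.
  have -> : lam * B k + (lam - 1) * (x - m k) = lam * B k - (1 - lam) * (x - m k) by lra.
  rewrite ge_max lexx andbT subr_ge0 mulrC -ler_pdivlMr//.
  by rewrite lerBlDl; exact: ltW.
have h3 : cumul Q r (s k.+1) <= 0.
  rewrite -(mul0r (s k.+1 - r)) -(cumul_cst 0 rs); apply: cumul_le;
    [exact: iQ|exact: loc_int_cst|].
  move=> x /andP[kx xk].
  have mx : m k <= x by exact: le_trans mr (ltW kx).
  apply: (le_trans (drained_open_le Q0 mx (ltW xk))).
  rewrite ge_max lexx/= subr_le0 -ler_pdivrMl// mulrC.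
  by rewrite lerBrDl; exact: ltW.
have -> : lam * B k ^+ 2 / (2 * (1 - lam)) =
    lam * B k ^+ 2 / 2 + ((lam * B k) ^+ 2 / (2 * (1 - lam)) + 0).
  by field; rewrite gt_eqF.
by rewrite lerD// lerD.
Qed.

(** The cycle length is bounded below only for [k > 0], because the opening cycle of cross traffic
    has just a yellow period as its blocked part. *)
Lemma drained_average_le Bm U : 0 < U -> (forall k, B k <= Bm) ->
  (forall k, (0 < k)%N -> U <= B k + D k) ->
  (long_run_average Q <= (lam * Bm ^+ 2 / (2 * (1 - lam) * U))%:E)%E.
Proof.
have hl0 := lam_ge0; have hl1 := lam_lt1 => U0 BBm UBD.
have l0 : 0 < 1 - lam by lra.
have Bm0 : 0 <= Bm := le_trans (B_ge0 0) (BBm 0%N).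
pose a := lam * Bm ^+ 2 / (2 * (1 - lam)).
have a0 : 0 <= a by rewrite /a divr_ge0// mulr_ge0 ?sqr_ge0// ltW.
have area k : cumul Q (s k) (s k.+1) <= a.
  apply: (le_trans (drained_cycle_area k)).
  rewrite ler_pM2r ?invr_gt0 ?mulr_gt0// ler_wpM2l// ler_pXn2r ?nnegrE//.
have sum_area k : cumul Q 0 (s k) <= a * k%:R.
  elim: k => [|k IH]; first by rewrite cyc_start0 cumul_bb mulr0.
  rewrite (cumul_split (c := s k) iQ); last 2 first.
  - exact: cyc_start_ge0.
  - exact: cyc_startSle.
  by rewrite -natr1 mulrDr mulr1 lerD.
(* The 1 accounts for the opening cycle, whose length is only known to be nonnegative. *)
have sU k : U * (k%:R - 1) <= s k.
  elim: k => [|[|k] IH]; first by rewrite cyc_start0; lra.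
    by rewrite subrr mulr0 cyc_start_ge0.
  rewrite cyc_startS /cyc_mid -[k.+2%:R]natr1.
  have := UBD k.+1 isT; lra.
have soo : s @ \oo --> +oo.
  apply/cvgryPge => b; near=> k; apply: le_trans (sU k).
  rewrite mulrC -ler_pdivrMr// lerBrDr.
  near: k; exact: nbhs_infty_ger.
apply/lee_addgt0Pr => e e0; rewrite -EFinD.
apply: long_run_average_le => //; near=> T.
have T0 : 0 <= T by near: T; exact: nbhs_pinfty_ge.
(* The areas of [K.+1] cycles are counted, while only [K - 1] lengths [U] are known to fit in [T];
   the slack [e] pays for the difference [2 * a]. *)
have Te : 2 * a / e <= T by near: T; apply: nbhs_pinfty_ge; exact: num_real.
have [K /andP[sKT TsK]] :=
  seq_interval (cyc_start0 B D) (cyc_start_homo B_ge0 D_ge0) soo T0.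
apply: (@le_trans _ _ (cumul Q 0 (s K.+1))).
  rewrite (cumul_split (c := T) iQ T0 (ltW TsK)) lerDl.
  by apply: cumul_ge0 => x _; exact: reflected_ge0.
apply: (le_trans (sum_area _)).
have -> : lam * Bm ^+ 2 / (2 * (1 - lam) * U) = a / U.
  by rewrite /a; field; rewrite !gt_eqF.
have h1 : K%:R - 1 <= T / U.
  by rewrite ler_pdivlMr// mulrC; exact: le_trans (sU K) sKT.
have h2 : 2 * a <= e * T by rewrite -ler_pdivrMl// mulrC.
have h3 : a * (K%:R - 1) <= a * (T / U) by rewrite ler_wpM2l.
rewrite -natr1; lra.
Unshelve. all: by end_near. Qed.

End SingleQueueUpper.

(** * Conservation of fluid at a node *)

Section QueueOutflow.
Context {R : realType}.
Variables (B D : nat -> R) (S : set R) (lam : R) (Q eta : R -> R).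
Hypothesis B_ge0 : forall k, 0 <= B k.
Hypothesis D_ge0 : forall k, 0 <= D k.
Hypothesis altS : alternates B D S.
Hypothesis lam_ge0 : 0 <= lam.
Hypothesis lam_lt1 : lam < 1.

Local Notation s := (cyc_start B D).
Local Notation m := (cyc_mid B D).

Hypothesis Q_ge0 : forall t, 0 <= Q t.
Hypothesis Q_drain : forall T t, 0 <= T -> T <= t -> Q T - (1 - lam) * (t - T) <= Q t.
Hypothesis Q_grow : forall k t, s k <= t -> t <= m k -> Q (s k) + lam * (t - s k) <= Q t.
Hypothesis ieta : loc_int eta.
Hypothesis eta_blocked : forall x, S x -> 0 <= eta x.
Hypothesis eta_open : forall x, ~ S x -> lam <= eta x.
Hypothesis eta_busy : forall x, ~ S x -> 0 < Q x -> 1 <= eta x.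

(** What has arrived and is not stored has left. In an open period the outflow is at least 1 until
    the earliest time [Q (m K) / (1 - lam)] after [m K] at which the queue can be empty, and at
    least [lam] afterwards; if the period ends sooner, the outflow is at least 1 throughout and the
    remaining queue accounts for the rest. *)
Lemma outflow_ge_arrivals K : lam * s K - Q (s K) <= cumul eta 0 (s K).
Proof.
have hl0 := lam_ge0; have hl1 := lam_lt1.
have l0 : 0 < 1 - lam by lra.
elim: K => [|K IH].
  by rewrite cyc_start0 mulr0 cumul_bb sub0r oppr_le0 Q_ge0.
have sK0 := cyc_start_ge0 B_ge0 D_ge0 K.
have mK0 := cyc_mid_ge0 B_ge0 D_ge0 K.
have sm : s K <= m K by exact: cyc_start_mid.
have ms : m K <= s K.+1 by exact: cyc_mid_startS.
rewrite (cumul_split (c := m K) ieta mK0 ms) (cumul_split (c := s K) ieta sK0 sm).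
have h1 : 0 <= cumul eta (s K) (m K).
  rewrite -(mul0r (m K - s K)) -cumul_cst//; apply: cumul_le => //;
    first exact: loc_int_cst.
  move=> x /andP[kx xk]; apply: eta_blocked; apply: (proj1 (altS K x)); lra.
have hm : Q (s K) + lam * B K <= Q (m K).
  have := Q_grow sm (lexx _).
  by have -> : m K - s K = B K by rewrite /cyc_mid; lra.
have Qm0 := Q_ge0 (m K).
have QS0 := Q_ge0 (s K.+1).
have open x : m K < x < s K.+1 -> ~ S x.
  by move=> ?; apply: (proj2 (altS K x)); lra.
suff h2 : Q (m K) + lam * D K - Q (s K.+1) <= cumul eta (m K) (s K.+1).
  have e1 : lam * s K.+1 = lam * s K + lam * B K + lam * D K.
    by rewrite cyc_startS /cyc_mid; lra.
  lra.
have DE : s K.+1 - m K = D K by rewrite cyc_startS; lra.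
have busy x : m K <= x -> x < s K.+1 -> (1 - lam) * (x - m K) < Q (m K) -> 0 < Q x.
  move=> mx xs h; have := Q_drain mK0 mx.
  lra.
have [h|h] := leP (Q (m K) / (1 - lam)) (D K); last first.
  have hD : (1 - lam) * D K < Q (m K) by rewrite mulrC -ltr_pdivlMr.
  have : 1 * (s K.+1 - m K) <= cumul eta (m K) (s K.+1).
    rewrite -cumul_cst//; apply: cumul_le => //; first exact: loc_int_cst.
    move=> x /[dup] mxs /andP[mx xs]; apply: eta_busy; first exact: open.
    apply: busy => //; first exact: ltW.
    by apply: le_lt_trans hD; rewrite ler_pM2l// -DE lerD2r ltW.
  have := Q_drain mK0 ms.
  rewrite DE; lra.
pose r := m K + Q (m K) / (1 - lam).
have mr : m K <= r by rewrite lerDl divr_ge0// ltW.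
have rs : r <= s K.+1 by rewrite cyc_startS lerD2l.
rewrite (cumul_split (c := r) ieta mr rs).
have : 1 * (r - m K) <= cumul eta (m K) r.
  rewrite -cumul_cst//; apply: cumul_le => //; first exact: loc_int_cst.
  move=> x /andP[mx xr]; have xs := lt_le_trans xr rs.
  apply: eta_busy; first by apply: open; rewrite mx.
  apply: busy => //; first exact: ltW.
  by rewrite mulrC -ltr_pdivlMr// ltrBlDl.
have : lam * (s K.+1 - r) <= cumul eta r (s K.+1).
  rewrite -cumul_cst//; apply: cumul_le => //; first exact: loc_int_cst.
  move=> x /andP[mx xr]; apply: eta_open; apply: open.
  by rewrite xr (le_lt_trans mr).
have -> : s K.+1 - r = D K - Q (m K) / (1 - lam) by rewrite /r cyc_startS; lra.
have -> : r - m K = Q (m K) / (1 - lam) by rewrite /r; lra.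
have e : (1 - lam) * (Q (m K) / (1 - lam)) = Q (m K).
  by field; rewrite gt_eqF.
move: e; set w := Q (m K) / (1 - lam); lra.
Qed.

End QueueOutflow.

(** * Sets of blocked times *)

Section AlternatingSet.
Context {R : realType}.
Variables B D : nat -> R.
Hypothesis B_ge0 : forall k, 0 <= B k.
Hypothesis D_ge0 : forall k, 0 <= D k.
Local Notation s := (cyc_start B D).
Local Notation m := (cyc_mid B D).

Definition blocked_set : set R := \bigcup_k `[s k, m k[%classic.

Lemma measurable_blocked_set : measurable blocked_set.
Proof. by apply: bigcup_measurable => k _; exact: measurable_itv. Qed.

Lemma alternates_blocked_set : alternates B D blocked_set.
Proof.
move=> k x; split; first by move=> h; exists k => //=; rewrite in_itv.
move=> /andP[mx xs] [j _ /=]; rewrite in_itv/= => /andP[sx xm].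
have [kj|jk|kj] := ltngtP k j.
- have := cyc_start_homo B_ge0 D_ge0 kj; lra.
- have := cyc_start_homo B_ge0 D_ge0 jk.
  have := cyc_mid_startS B D_ge0 j; have := cyc_start_mid D B_ge0 k; lra.
- by rewrite kj in mx; lra.
Qed.

Lemma cumul_blocked_set (S : set R) (f : R -> R) K : alternates B D S -> measurable S ->
  loc_int f -> loc_int (fun x => f x * \1_S x) ->
  cumul (fun x => f x * \1_S x) 0 (s K) = \sum_(0 <= j < K) cumul f (s j) (m j).
Proof.
move=> altS mS If IfS.
have sm k : s k <= m k by exact: cyc_start_mid.
have ms k : m k <= s k.+1 by exact: cyc_mid_startS.
elim: K => [|K IH]; first by rewrite big_geq// cyc_start0 cumul_bb.
rewrite big_nat_recr//= -IH (cumul_split (c := s K) IfS); last 2 first.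
- exact: cyc_start_ge0.
- exact: cyc_startSle.
rewrite (cumul_split (c := m K) IfS (sm K) (ms K)); congr (_ + _).
rewrite -[RHS]addr0; congr (_ + _).
  apply: cumul_eq => // x /andP[kx xk].
  by rewrite indicE mem_set ?mulr1//; apply: (proj1 (altS K x)); lra.
rewrite -(mul0r (s K.+1 - m K)) -cumul_cst//; apply: cumul_eq => //;
  first exact: loc_int_cst.
move=> x /andP[kx xk].
by rewrite indicE memNset ?mulr0//; apply: (proj2 (altS K x)); lra.
Qed.

Lemma cumul_indic_start (S : set R) K : alternates B D S -> measurable S ->
  cumul \1_S 0 (s K) = \sum_(0 <= j < K) B j.
Proof.
move=> altS mS; have IS := loc_int_indic mS.
have I1 : loc_int (fun x => 1 * \1_S x : R) by exact: loc_intZ.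
transitivity (cumul (fun x => 1 * \1_S x : R) 0 (s K)).
  by apply: eq_cumul => x; rewrite mul1r.
rewrite (cumul_blocked_set K altS mS (loc_int_cst 1) I1).
apply: eq_bigr => j _; rewrite cumul_cst ?cyc_start_mid// mul1r /cyc_mid; lra.
Qed.

(** Right-continuity of a light. The positive mean cycle length makes the cycle starts diverge, so
    every time lies in some cycle and before its next switch. *)
Lemma alternates_cover (S : set R) (U x : R) : alternates B D S -> 0 < U ->
  (fun K => K%:R^-1 * s K) @ \oo --> U -> 0 <= x ->
  exists y, x < y /\ forall z, x <= z < y -> (S z <-> S x).
Proof.
move=> altS U0 sU x0.
have [K /andP[sx xs]] := seq_interval (cyc_start0 B D)
  (cyc_start_homo B_ge0 D_ge0) (cesaro_pinfty U0 sU) x0.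
have [xm|mx] := ltP x (m K).
  exists (m K); split => // z /andP[xz zm].
  have hz : S z by apply: (proj1 (altS K z)); rewrite zm (le_trans sx).
  by have hx : S x by apply: (proj1 (altS K x)); rewrite sx.
exists (s K.+1); split => // z /andP[xz zm].
have hz : ~ S z by apply: (proj2 (altS K z)); rewrite zm (le_trans mx).
by have hx : ~ S x by apply: (proj2 (altS K x)); rewrite mx.
Qed.

End AlternatingSet.

(** * The lights of the model as alternating sets *)

Section Model.
Context {R : realType}.
Variables (A : avenue R) (p : policy R) (n : nat).

Definition nongreen_len k : R := yellow_dur A n + red_dur p n k.+1 + orange_dur A n.
Definition green_len k : R := green_dur p n k.+1.
(** A non-red stretch runs over the end of a model cycle: orange and green of one cycle, then yellow
    of the next. For [k = 0] only the opening yellow is left. *)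
Definition nonred_len k : R :=
  if k is j.+1 then orange_dur A n + green_dur p n j.+1 + yellow_dur A n
  else yellow_dur A n.
Definition red_len k : R := red_dur p n k.+1.

Hypothesis Y_ge0 : 0 <= yellow_dur A n.
Hypothesis O_ge0 : 0 <= orange_dur A n.
Hypothesis dur_ge0 : forall k, (1 <= k)%N -> 0 <= green_dur p n k /\ 0 <= red_dur p n k.

Lemma nongreen_len_ge0 k : 0 <= nongreen_len k.
Proof. by rewrite /nongreen_len !addr_ge0//; case: (@dur_ge0 k.+1). Qed.

Lemma green_len_ge0 k : 0 <= green_len k.
Proof. by case: (@dur_ge0 k.+1). Qed.

Lemma nonred_len_ge0 k : 0 <= nonred_len k.
Proof. by case: k => //= k; rewrite !addr_ge0//; case: (@dur_ge0 k.+1). Qed.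

Lemma red_len_ge0 k : 0 <= red_len k.
Proof. by case: (@dur_ge0 k.+1). Qed.

Lemma cyc_start_nongreen k : cyc_start nongreen_len green_len k = cycle_start A p n k.+1.
Proof. by rewrite /cyc_start /cycle_start big_add1/=. Qed.

Lemma cyc_mid_nongreen k : cyc_mid nongreen_len green_len k = orange_end A p n k.+1.
Proof.
rewrite /cyc_mid cyc_start_nongreen /nongreen_len /orange_end /red_end /yellow_end.
by rewrite !addrA.
Qed.

Lemma cyc_mid_nonred k : cyc_mid nonred_len red_len k = yellow_end A p n k.+1.
Proof.
elim: k => [|k IH].
  by rewrite /cyc_mid cyc_start0 /yellow_end /cycle_start big_geq.
rewrite {1}/cyc_mid cyc_startS IH /yellow_end [in RHS]/cycle_start big_nat_recr//=.
by rewrite -/(cycle_start A p n k.+1) /red_len; lra.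
Qed.

Lemma cyc_start_nonred0 : cyc_start nonred_len red_len 0 = cycle_start A p n 1.
Proof. by rewrite cyc_start0 /cycle_start big_geq. Qed.

Lemma cyc_start_nonredS k : cyc_start nonred_len red_len k.+1 = red_end A p n k.+1.
Proof. by rewrite cyc_startS cyc_mid_nonred. Qed.

Lemma cycle_startS k : (1 <= k)%N ->
  cycle_start A p n k.+1 = orange_end A p n k + green_dur p n k.
Proof.
move=> k1; rewrite /cycle_start big_nat_recr//= -/(cycle_start A p n k).
rewrite /orange_end /red_end /yellow_end; lra.
Qed.

Lemma nongreenE : nongreen A p n = blocked_set nongreen_len green_len.
Proof.
have hY := Y_ge0; have hO := O_ge0.
have ord k : [/\ cycle_start A p n k.+1 <= yellow_end A p n k.+1,
    yellow_end A p n k.+1 <= red_end A p n k.+1 &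
    red_end A p n k.+1 <= orange_end A p n k.+1].
  have [_ hr] := @dur_ge0 k.+1 isT.
  by rewrite /orange_end /red_end /yellow_end; split; lra.
apply/seteqP; split => x.
  case=> [[|]|] [[|k] //= _]; rewrite in_itv/= => /andP[h1 h2];
    have [? ? ?] := ord k; exists k => //=;
    rewrite in_itv/= cyc_start_nongreen cyc_mid_nongreen; apply/andP; split; lra.
case=> k _ /=; rewrite in_itv/= cyc_start_nongreen cyc_mid_nongreen => /andP[h1 h2].
have [? ? ?] := ord k.
have [xy|yx] := ltP x (yellow_end A p n k.+1).
  by left; left; exists k.+1 => //=; rewrite in_itv/= h1.
have [xr|rx] := ltP x (red_end A p n k.+1).
  by left; right; exists k.+1 => //=; rewrite in_itv/= yx.
by right; exists k.+1 => //=; rewrite in_itv/= rx.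
Qed.

Lemma nonredE : nonred A p n = blocked_set nonred_len red_len.
Proof.
have hY := Y_ge0; have hO := O_ge0.
have ord k : [/\ red_end A p n k.+1 <= orange_end A p n k.+1,
    orange_end A p n k.+1 <= cycle_start A p n k.+2 &
    cycle_start A p n k.+2 <= yellow_end A p n k.+2].
  have [hg _] := @dur_ge0 k.+1 isT.
  have e : yellow_end A p n k.+2 = cycle_start A p n k.+2 + yellow_dur A n by [].
  by rewrite e cycle_startS// /orange_end; split; lra.
apply/seteqP; split => x.
  case=> [[|]|] [[|k] //= _]; rewrite in_itv/= => /andP[h1 h2].
  - have [? ? ?] := ord k; exists k.+1 => //=.
    rewrite in_itv/= cyc_start_nonredS cyc_mid_nonred; apply/andP; split; lra.
  - have [? ? ?] := ord k; exists k.+1 => //=.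
    rewrite in_itv/= cyc_start_nonredS cyc_mid_nonred; apply/andP; split; lra.
  - case: k h1 h2 => [|k] h1 h2.
      exists 0%N => //=; rewrite in_itv/= cyc_start_nonred0 cyc_mid_nonred.
      by rewrite h1.
    have [? ? ?] := ord k; exists k.+1 => //=.
    rewrite in_itv/= cyc_start_nonredS cyc_mid_nonred; apply/andP; split; lra.
case=> [[|k]] _ /=; rewrite in_itv/= cyc_mid_nonred.
  by rewrite cyc_start_nonred0 => h; right; exists 1%N => //=; rewrite in_itv.
rewrite cyc_start_nonredS => /andP[h1 h2].
have [? ? ?] := ord k.
have [xy|yx] := ltP x (orange_end A p n k.+1).
  by left; left; exists k.+1 => //=; rewrite in_itv/= h1.
have [xr|rx] := ltP x (cycle_start A p n k.+2).
  by left; right; exists k.+1 => //=; rewrite in_itv/= yx.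
by right; exists k.+2 => //=; rewrite in_itv/= rx.
Qed.

Lemma measurable_nongreen : measurable (nongreen A p n).
Proof. by rewrite nongreenE; exact: measurable_blocked_set. Qed.

Lemma measurable_nonred : measurable (nonred A p n).
Proof. by rewrite nonredE; exact: measurable_blocked_set. Qed.

Lemma alternates_nongreen : alternates nongreen_len green_len (nongreen A p n).
Proof.
rewrite nongreenE; apply: alternates_blocked_set.
  exact: nongreen_len_ge0.
exact: green_len_ge0.
Qed.

Lemma alternates_nonred : alternates nonred_len red_len (nonred A p n).
Proof.
rewrite nonredE; apply: alternates_blocked_set.
  exact: nonred_len_ge0.
exact: red_len_ge0.
Qed.

Lemma cesaro_cst (k : R) : (fun K : nat => K%:R^-1 * (K%:R * k)) @ \oo --> k.
Proof.
apply: cvg_near_cst; near=> K.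
have K0 : (K%:R : R) != 0 by rewrite pnatr_eq0 -lt0n; near: K; exact: nbhs_infty_gt.
by rewrite mulrA mulVf// mul1r.
Unshelve. all: by end_near. Qed.

Hypothesis cvg_green : cvg (cycle_average (green_dur p n) @ \oo).
Hypothesis cvg_red : cvg (cycle_average (red_dur p n) @ \oo).

Lemma green_len_mean :
  (fun K => K%:R^-1 * \sum_(0 <= j < K) green_len j) @ \oo --> mean_green p n.
Proof.
have := cvg_green; rewrite /mean_green/cycle_average.
by under eq_fun do rewrite big_add1/=.
Qed.

Lemma red_len_mean :
  (fun K => K%:R^-1 * \sum_(0 <= j < K) red_len j) @ \oo --> mean_red p n.
Proof.
have := cvg_red; rewrite /mean_red/cycle_average.
by under eq_fun do rewrite big_add1/=.
Qed.

Lemma nongreen_len_mean :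
  (fun K => K%:R^-1 * \sum_(0 <= j < K) nongreen_len j) @ \oo -->
  mean_red p n + (yellow_dur A n + orange_dur A n).
Proof.
have h : (fun K => K%:R^-1 * (\sum_(0 <= j < K) red_len j) +
    K%:R^-1 * (K%:R * (yellow_dur A n + orange_dur A n))) @ \oo -->
    mean_red p n + (yellow_dur A n + orange_dur A n).
  by apply: cvgD; [exact: red_len_mean|exact: cesaro_cst].
apply: cvg_trans h; apply: near_eq_cvg; near=> K.
rewrite /= -mulrDr; congr (_ * _).
have -> : K%:R * (yellow_dur A n + orange_dur A n) =
    \sum_(0 <= j < K) (yellow_dur A n + orange_dur A n).
  by rewrite sumr_const_nat subn0 mulr_natl.
by rewrite -big_split/=; apply: eq_bigr => j _; rewrite /nongreen_len /red_len; lra.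
Unshelve. all: by end_near. Qed.

(** Shifting the index splits off the irregular first period, whose share vanishes; the factor
    [1 - K.+1%:R^-1] turns a mean over [K] periods into one over [K.+1]. *)
Lemma nonred_len_mean :
  (fun K => K%:R^-1 * \sum_(0 <= j < K) nonred_len j) @ \oo -->
  mean_green p n + (yellow_dur A n + orange_dur A n).
Proof.
rewrite -cvg_shiftS/=.
have h1 : (fun K : nat => K.+1%:R^-1 * yellow_dur A n) @ \oo --> 0 * yellow_dur A n.
  by apply: cvgM; [exact: cvg_harmonic|exact: cvg_cst].
rewrite mul0r in h1.
pose F K : R := \sum_(0 <= j < K) (orange_dur A n + green_len j + yellow_dur A n).
have h2 : (fun K => K%:R^-1 * F K) @ \oo --> mean_green p n + (yellow_dur A n +
  orange_dur A n).
  have h : (fun K => K%:R^-1 * (\sum_(0 <= j < K) green_len j) +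
      K%:R^-1 * (K%:R * (yellow_dur A n + orange_dur A n))) @ \oo -->
      mean_green p n + (yellow_dur A n + orange_dur A n).
    by apply: cvgD; [exact: green_len_mean|exact: cesaro_cst].
  apply: cvg_trans h; apply: near_eq_cvg; near=> K.
  rewrite /= -mulrDr; congr (_ * _).
  have -> : K%:R * (yellow_dur A n + orange_dur A n) =
      \sum_(0 <= j < K) (yellow_dur A n + orange_dur A n).
    by rewrite sumr_const_nat subn0 mulr_natl.
  by rewrite -big_split/=; apply: eq_bigr => j _; lra.
have h3 : (fun K : nat => (1 - K.+1%:R^-1) * (K%:R^-1 * F K)) @ \oo -->
    (1 - 0) * (mean_green p n + (yellow_dur A n + orange_dur A n)).
  apply: cvgM => //; apply: cvgB; [exact: cvg_cst|exact: cvg_harmonic].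
rewrite subr0 mul1r in h3.
have h4 : (fun K : nat => K.+1%:R^-1 * yellow_dur A n +
    (1 - K.+1%:R^-1) * (K%:R^-1 * F K)) @ \oo -->
    mean_green p n + (yellow_dur A n + orange_dur A n).
  by rewrite -[X in _ --> X]add0r; exact: cvgD.
apply: cvg_trans h4; apply: near_eq_cvg; near=> K.
have K0 : (K%:R : R) != 0 by rewrite pnatr_eq0 -lt0n; near: K; exact: nbhs_infty_gt.
rewrite /= big_nat_recl//= -/(F K).
have K1 : (K%:R + 1 : R) != 0 by rewrite natr1 pnatr_eq0.
by rewrite -natr1; field; rewrite K0 K1.
Unshelve. all: by end_near. Qed.

End Model.

(** * Functions of zero density *)

Section Density.
Context {R : realType}.
Implicit Types (f g : R -> R) (S : set R).

Definition null_density f := (fun T : R => T^-1 * cumul f 0 T) @ +oo --> (0 : R).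

Lemma null_density_le f g : loc_int f -> loc_int g -> (forall x, 0 <= f x) ->
  (forall x, 0 < x -> f x <= g x) -> null_density g -> null_density f.
Proof.
move=> If Ig f0 fg ng.
apply: (squeeze_cvgr _ (cvg_cst 0) ng); near=> T.
have T0 : 0 < T by near: T; apply: nbhs_pinfty_gt; rewrite ?num_real.
rewrite mulr_ge0 ?invr_ge0 ?(ltW T0)//=; last by apply: cumul_ge0.
rewrite ler_pM2l ?invr_gt0//; apply: cumul_le => // x /andP[x0 _]; exact: fg.
Unshelve. all: by end_near. Qed.

Lemma null_densityD f g : loc_int f -> loc_int g -> null_density f -> null_density g ->
  null_density (fun x => f x + g x).
Proof.
move=> If Ig nf ng; rewrite /null_density.
under eq_fun do rewrite cumulD// mulrDr.
have := cvgD nf ng; rewrite addr0. exact.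
Qed.

(** Stability under products and under [1 - f] lets indicators and outflow rates be combined without
    separate measurability and bound arguments. *)
Definition flow f := measurable_fun setT f /\ forall x, 0 <= f x <= 1.

Lemma flow_loc_int f : flow f -> loc_int f.
Proof.
move=> [mf f1]; apply: (@loc_int_bounded _ _ 1) => // x.
by have /andP[? ?] := f1 x; rewrite ger0_norm.
Qed.

Lemma flow_rate_fun f S : flow f -> measurable S ->
  rate_fun (fun x => f x - 1 + \1_S x).
Proof.
move=> fl mS; split.
  apply: loc_intD; last exact: loc_int_indic.
  by apply: loc_intB; [exact: flow_loc_int|exact: loc_int_cst].
move=> x; have /andP[f0 f1] := proj2 fl x; rewrite indicE ler_norml.
by case: (x \in S); rewrite ?mulr1n ?mulr0n; apply/andP; split; lra.
Qed.

Lemma flow_cst (a : R) : 0 <= a <= 1 -> flow (fun=> a).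
Proof. by move=> a01; split. Qed.

Lemma flow_indic S : measurable S -> flow \1_S.
Proof.
move=> mS; split; first exact: measurable_indic.
by move=> x; rewrite indicE ler0n; case: (x \in S); rewrite ?ler01 ?lexx.
Qed.

Lemma flowM f g : flow f -> flow g -> flow (fun x => f x * g x).
Proof.
move=> [mf f1] [mg g1]; split; first exact: measurable_funM.
move=> x; have /andP[? ?] := f1 x; have /andP[? ?] := g1 x.
by rewrite mulr_ge0// mulr_ile1.
Qed.

Lemma flow_onem f : flow f -> flow (fun x => 1 - f x).
Proof.
move=> [mf f1]; split; first by apply: measurable_funB.
move=> x; have /andP[? ?] := f1 x; apply/andP; split; lra.
Qed.

End Density.

(** * Fluid arriving at a blocked node *)

Section Blocked.
Context {R : realType}.
Variables (B D : nat -> R) (S : set R) (f : R -> R) (U : R).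
Hypothesis B_ge0 : forall k, 0 <= B k.
Hypothesis D_ge0 : forall k, 0 <= D k.
Hypothesis mS : measurable S.
Hypothesis altS : alternates B D S.
Hypothesis U_gt0 : 0 < U.
Hypothesis sU : (fun K => K%:R^-1 * cyc_start B D K) @ \oo --> U.
Hypothesis flow_f : flow f.
Local Notation s := (cyc_start B D).
Local Notation m := (cyc_mid B D).
Let u (x : R) : R := f x - 1 + \1_S x.
Let Q := reflected u.
Let ru : rate_fun u := flow_rate_fun flow_f mS.
Let iQ : loc_int Q := reflected_loc_int ru.
Let If : loc_int f := flow_loc_int flow_f.
Let IfS : loc_int (fun x => f x * \1_S x) := flow_loc_int (flowM flow_f (flow_indic mS)).

(* Inflow during a blocked period accumulates: as it comes at rate at most 1, the
   queue dominates a unit-slope triangle ending at the end of the period. *)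
Lemma blocked_inflow_area k : (cumul f (s k) (m k)) ^+ 2 / 2 <= cumul Q (s k) (s k.+1).
Proof.
have sk0 := cyc_start_ge0 B_ge0 D_ge0 k.
have sm : s k <= m k by exact: cyc_start_mid.
have ms : m k <= s k.+1 by exact: cyc_mid_startS.
set z := cumul f (s k) (m k).
have fle b t : b <= t -> cumul f b t <= t - b.
  move=> bt; rewrite -[leRHS]mul1r -cumul_cst//; apply: cumul_le => //;
    first exact: loc_int_cst.
  by move=> x _; have /andP[] := proj2 flow_f x.
have z0 : 0 <= z by apply: cumul_ge0 => x _; have /andP[] := proj2 flow_f x.
have zm : z <= m k - s k by exact: fle.
have h1 : s k <= m k - z by lra.
have h2 : m k - z <= m k by lra.
have Q0 a b : 0 <= cumul Q a b by apply: cumul_ge0 => x _; exact: reflected_ge0.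
rewrite (cumul_split (c := m k) iQ sm ms) (cumul_split (c := m k - z) iQ h1 h2).
suff : z ^+ 2 / 2 <= cumul Q (m k - z) (m k).
  have := Q0 (s k) (m k - z); have := Q0 (m k) (s k.+1); lra.
have -> : z ^+ 2 / 2 = cumul (fun x => 0 + 1 * (x - (m k - z))) (m k - z) (m k).
  by rewrite cumul_affine//; lra.
apply: cumul_le => //; first exact: loc_int_affine.
move=> x /andP[/ltW zx /ltW xm]; have sx := le_trans h1 zx.
apply: (@le_trans _ _ (cumul u (s k) x)); last by apply: reflected_ge_cumul; rewrite ?sk0.
have -> : cumul u (s k) x = cumul f (s k) x.
  apply: cumul_eq => //; first by case: ru.
  move=> y /andP[sy yx]; rewrite /u indicE mem_set ?subrK//.
  by apply: (proj1 (altS k y)); rewrite ltW//= (lt_le_trans yx).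
have := fle _ _ xm; have := cumul_split If sx xm; rewrite -/z; lra.
Qed.

Lemma cesaro_blocked_time (beta : R) :
  (fun K => K%:R^-1 * \sum_(0 <= j < K) B j) @ \oo --> beta ->
  (fun T : R => T^-1 * cumul \1_S 0 T) @ +oo --> beta / U.
Proof.
move=> Bb; have IS := loc_int_indic mS.
apply: (cesaro_interpolation (s := s)) => //.
- exact: cyc_start0.
- exact: cyc_start_homo.
- move=> x y x0 xy; rewrite (cumul_split IS x0 xy) lerDl.
  by apply: cumul_ge0 => z _; have /andP[] := proj2 (flow_indic mS) z.
- by move=> x x0; apply: cumul_ge0 => z _; have /andP[] := proj2 (flow_indic mS) z.
by under eq_fun do rewrite (cumul_indic_start B_ge0 D_ge0 _ altS mS).
Qed.

(** The area controls only the squares of the inflows [z j]. The inequality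
    [e * z <= z ^+ 2 / 2 + e ^+ 2 / 2] recovers their sum: a mean area of at most [e ^+ 2 / 2] per
    cycle gives a mean inflow of at most [e]. *)
Lemma blocked_inflow_null_density : null_density Q -> null_density (fun x => f x * \1_S x).
Proof.
move=> nQ; suff : (fun T :
  R => T^-1 * cumul (fun x => f x * \1_S x) 0 T) @ +oo --> 0 / U by rewrite mul0r.
have fS0 x : 0 <= f x * \1_S x.
  by have /andP[] := proj2 (flowM flow_f (flow_indic mS)) x.
apply: (cesaro_interpolation (s := s)) => //.
- exact: cyc_start0.
- exact: cyc_start_homo.
- by move=> x y x0 xy; rewrite (cumul_split IfS x0 xy) lerDl cumul_ge0.
- by move=> x x0; exact: cumul_ge0.
under eq_fun do rewrite cumul_blocked_set//.
pose z j := cumul f (s j) (m j).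
have z0 j : 0 <= z j by apply: cumul_ge0 => x _; have /andP[] := proj2 flow_f x.
have hA K : \sum_(0 <= j < K) z j ^+ 2 / 2 <= cumul Q 0 (s K).
  elim: K => [|K IH]; first by rewrite big_geq// cyc_start0 cumul_bb.
  rewrite big_nat_recr//= (cumul_split (c := s K) iQ); last 2 first.
  - exact: cyc_start_ge0.
  - exact: cyc_startSle.
  by rewrite lerD// blocked_inflow_area.
have nQs := cvg_along U_gt0 sU nQ; rewrite mulr0 in nQs.
apply/cvgrPdist_le => e e0; near=> K.
have K0 : (0 : R) < K%:R by rewrite ltr0n; near: K; exact: nbhs_infty_gt.
rewrite sub0r normrN ger0_norm;
  last by rewrite mulr_ge0 ?invr_ge0 ?(ltW K0)// sumr_ge0// => j _; exact: z0.
have h : K%:R^-1 * cumul Q 0 (s K) <= e ^+ 2 / 2.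
  apply: (le_trans (ler_norm _)); rewrite -normrN -sub0r.
  near: K; move/cvgrPdist_le : nQs; apply; rewrite divr_gt0// exprn_gt0//.
rewrite mulrC ler_pdivrMr//; rewrite mulrC ler_pdivrMr// in h.
have h2 : e * \sum_(0 <= j < K) z j <= \sum_(0 <= j < K) z j ^+ 2 / 2 + K%:R * (e ^+ 2 / 2).
  have -> : K%:R * (e ^+ 2 / 2) = \sum_(0 <= j < K) e ^+ 2 / 2.
    by rewrite sumr_const_nat subn0 mulr_natl.
  rewrite mulr_sumr -big_split/=; apply: ler_sum => j _.
  by rewrite -subr_ge0; have := sqr_ge0 (z j - e); lra.
rewrite -(ler_pM2l e0).
have := hA K; move: h h2; rewrite -/(z _); set a := \sum_(0 <= j < K) _; lra.
Unshelve. all: by end_near. Qed.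

End Blocked.

(** * Idle open time at critical load *)

Section IdleTime.
Context {R : realType}.
Variables (B D : nat -> R) (S : set R) (lam beta delta : R) (eta : R -> R).
Hypothesis B_ge0 : forall k, 0 <= B k.
Hypothesis D_ge0 : forall k, 0 <= D k.
Hypothesis mS : measurable S.
Hypothesis altS : alternates B D S.
Hypothesis lam_ge0 : 0 <= lam.
Hypothesis lam_lt1 : lam < 1.
Hypothesis Bb : (fun K => K%:R^-1 * \sum_(0 <= j < K) B j) @ \oo --> beta.
Hypothesis Dd : (fun K => K%:R^-1 * \sum_(0 <= j < K) D j) @ \oo --> delta.
Hypothesis U_gt0 : 0 < beta + delta.
Hypothesis critical : delta = lam * (beta + delta).
Local Notation s := (cyc_start B D).
Let Q := reflected (fun x : R => lam - 1 + \1_S x).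
Hypothesis flow_eta : flow eta.
Hypothesis eta_blocked : forall x, S x -> eta x = 0.
Hypothesis eta_open : forall x, ~ S x -> lam <= eta x.
Hypothesis eta_busy : forall x, ~ S x -> 0 < Q x -> 1 <= eta x.

(** Over [K] cycles the open time is about [delta * K], while the outflow is at least
    [lam * s K - Q (s K)], about [lam * (beta + delta) * K] since the queue is sublinear. By
    [critical] the two agree to first order, which leaves [o(K)] for idleness. *)
Lemma idle_null_density C : 0 <= C -> (\forall T \near +oo, cumul Q 0 T <= C * T) ->
  null_density (fun x => 1 - \1_S x - eta x).
Proof.
move=> C0 HC.
have sU := cyc_start_mean Bb Dd.
have Qo := single_sublinear mS lam_ge0 lam_lt1 C0 HC.
have Qs := cvg_along U_gt0 sU Qo; rewrite mulr0 in Qs.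
have ru := single_rate_fun mS lam_ge0 lam_lt1.
have drain := single_drain mS lam_ge0 lam_lt1.
have grow := single_grow B_ge0 D_ge0 mS altS lam_ge0 lam_lt1.
have IS := loc_int_indic mS.
have I1 : loc_int (fun x : R => 1 - \1_S x) by apply: loc_intB => //; exact: loc_int_cst.
have Ieta := flow_loc_int flow_eta.
have Ig : loc_int (fun x => 1 - \1_S x - eta x) by exact: loc_intB.
have g0 x : 0 <= 1 - \1_S x - eta x.
  rewrite indicE; have /andP[? ?] := proj2 flow_eta x.
  have [Sx|Sx] := pselect (S x).
    by rewrite mem_set// eta_blocked// subrr subr0.
  by rewrite memNset//; rewrite subr0 subr_ge0.
suff : (fun T : R => T^-1 * cumul (fun x => 1 - \1_S x - eta x) 0 T) @ +oo -->
    0 / (beta + delta) by rewrite mul0r.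
apply: (cesaro_interpolation (s := s)) => //.
- exact: cyc_start0.
- exact: cyc_start_homo.
- by move=> x y x0 xy; rewrite (cumul_split Ig x0 xy) lerDl cumul_ge0.
- by move=> x x0; exact: cumul_ge0.
have ub : (fun K => K%:R^-1 * s K - K%:R^-1 * (\sum_(0 <= j < K) B j)
    - lam * (K%:R^-1 * s K) + K%:R^-1 * Q (s K)) @ \oo -->
    (beta + delta - beta - lam * (beta + delta) + 0).
  apply: cvgD => //; apply: cvgB; first exact: cvgB.
  by apply: cvgM => //; exact: cvg_cst.
have e0 : beta + delta - beta - lam * (beta + delta) + 0 = 0.
  by rewrite -critical; lra.
rewrite e0 in ub.
apply: (squeeze_cvgr _ (cvg_cst 0) ub); near=> K.
have K0 : (0 : R) < K%:R by rewrite ltr0n; near: K; exact: nbhs_infty_gt.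
rewrite mulr_ge0 ?invr_ge0 ?(ltW K0)//=; last exact: cumul_ge0.
have -> : K%:R^-1 * s K - K%:R^-1 * (\sum_(0 <= j < K) B j)
    - lam * (K%:R^-1 * s K) + K%:R^-1 * Q (s K) =
  K%:R^-1 * (s K - \sum_(0 <= j < K) B j - (lam * s K - Q (s K))) by lra.
rewrite ler_pM2l ?invr_gt0// cumulB// cumulB//; last exact: loc_int_cst.
have sK0 := cyc_start_ge0 B_ge0 D_ge0 K.
rewrite cumul_cst// mul1r subr0.
rewrite (cumul_indic_start B_ge0 D_ge0 _ altS mS).
rewrite lerD2l lerN2.
apply: (outflow_ge_arrivals B_ge0 D_ge0 altS lam_ge0 lam_lt1 _ drain grow) => //.
  by move=> t; exact: reflected_ge0.
by move=> x /eta_blocked ->.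
Unshelve. all: by end_near. Qed.

End IdleTime.

(** * Passing from one node to the next *)

Section Pair.
Context {R : realType}.
Variables (N M : set R) (eta : R -> R) (c : R).
Hypothesis mN : measurable N.
Hypothesis mM : measurable M.
Hypothesis flow_eta : flow eta.
Hypothesis eta_blocked : forall x, N x -> eta x = 0.
Hypothesis idle : null_density (fun x => 1 - \1_N x - eta x).
Hypothesis blocked : null_density (fun x => eta x * \1_M x).
Hypothesis densN : (fun T : R => T^-1 * cumul \1_N 0 T) @ +oo --> c.
Hypothesis densM : (fun T : R => T^-1 * cumul \1_M 0 T) @ +oo --> c.

(** Shaped like the set in [nongreen_coincide], to which it is finally converted. *)
Definition symdiff (P P' : set R) := (P `\` P') `|` (P' `\` P).

Lemma measurable_symdiff P P' : measurable P -> measurable P' ->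
  measurable (symdiff P P').
Proof. by move=> mP mP'; apply: measurableU; exact: measurableD. Qed.

Let IN := loc_int_indic mN.
Let IM := loc_int_indic mM.
Let Ieta := flow_loc_int flow_eta.
Let I1N : loc_int (fun x : R => 1 - \1_N x).
Proof. by apply: loc_intB => //; exact: loc_int_cst. Qed.
Let Iidle : loc_int (fun x => 1 - \1_N x - eta x).
Proof. exact: loc_intB. Qed.
Let Iblocked : loc_int (fun x => eta x * \1_M x) :=
  flow_loc_int (flowM flow_eta (flow_indic mM)).

(** A time in [M] but not in [N] is either idle at the first node or sends fluid into the blocked
    second node, so [M \ N] has density 0. Since [N] and [M] have the same density, [N \ M] follows
    from [\1_(symdiff N M) = 2 * \1_(M \ N) + \1_N - \1_M]. *)
Lemma symdiff_null_density : null_density \1_(symdiff N M).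
Proof.
have mMN : measurable (M `\` N) by exact: measurableD.
have h1 : null_density \1_(M `\` N).
  apply: (@null_density_le _ _ (fun x => (1 - \1_N x - eta x) + eta x * \1_M x)).
  - exact: loc_int_indic.
  - exact: loc_intD.
  - by move=> x; have /andP[] := proj2 (flow_indic mMN) x.
  - move=> x _; rewrite !indicE in_setD.
    have /andP[? ?] := proj2 flow_eta x.
    have [Nx|Nx] := pselect (N x).
      by rewrite (mem_set Nx) eta_blocked// andbF mulr1n mulr0n subrr mul0r subr0 addr0.
    rewrite (memNset Nx) andbT; case: (x \in M); rewrite ?mulr1n ?mulr0n; lra.
  - exact: null_densityD.
have e x : \1_(symdiff N M) x = 2 * \1_(M `\` N) x + (\1_N x - \1_M x) :> R.
  rewrite /symdiff !indicE in_setU !in_setD.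
  by case: (x \in N); case: (x \in M) => /=; rewrite ?mulr1n ?mulr0n; lra.
rewrite /null_density.
under eq_fun do rewrite (eq_cumul _ _ e).
have IMN := loc_int_indic mMN.
have I2 : loc_int (fun x : R => 2 * \1_(M `\` N) x) by exact: loc_intZ.
have I3 : loc_int (fun x : R => \1_N x - \1_M x) by exact: loc_intB.
under eq_fun do rewrite cumulD// cumulZ// cumulB// mulrDr mulrCA mulrBr.
have := cvgD (cvgM (cvg_cst (2 : R)) h1) (cvgB densN densM).
rewrite mulr0 subrr addr0. exact.
Qed.

(** An open time of the second node that is also open at the first carries at least the outflow of
    the first, so it is no more idle there; the other open times lie in the symmetric difference. *)
Lemma idle_null_density_next (eta' : R -> R) : flow eta' ->
  (forall x, M x -> eta' x = 0) -> (forall x, ~ M x -> eta x <= eta' x) ->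
  null_density (fun x => 1 - \1_M x - eta' x).
Proof.
move=> fl' b' o'.
have Is : loc_int (\1_(symdiff N M) : R -> R) by apply: loc_int_indic;
  exact: measurable_symdiff.
apply: (@null_density_le _ _ (fun x => (1 - \1_N x - eta x) + \1_(symdiff N M) x)).
- apply: loc_intB; last exact: flow_loc_int.
  by apply: loc_intB => //; exact: loc_int_cst.
- exact: loc_intD.
- move=> x; have /andP[? ?] := proj2 fl' x; rewrite indicE.
  have [Mx|Mx] := pselect (M x).
    rewrite (mem_set Mx) b'// ?mulr1n; lra.
  rewrite (memNset Mx) mulr0n; lra.
- move=> x _; have /andP[? ?] := proj2 flow_eta x.
  have /andP[? ?] := proj2 fl' x; rewrite /symdiff !indicE in_setU !in_setD.
  have [Mx|Mx] := pselect (M x); have [Nx|Nx] := pselect (N x).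
  + rewrite (mem_set Mx) (mem_set Nx) b'// eta_blocked//=; rewrite ?mulr1n ?mulr0n; lra.
  + rewrite (mem_set Mx) (memNset Nx) b'//=; rewrite ?mulr1n ?mulr0n; lra.
  + rewrite (memNset Mx) (mem_set Nx) eta_blocked//=; rewrite ?mulr1n ?mulr0n; lra.
  + have := o' _ Mx; rewrite (memNset Mx) (memNset Nx)/= ?mulr1n ?mulr0n; lra.
- by apply: null_densityD => //; exact: symdiff_null_density.
Qed.

End Pair.

(** * The optimal cycle length *)

Section CycleTradeoff.
Context {R : realFieldType}.
(** [a] is the load of the traffic whose queue is measured and [G] its mean open time; [b] and [D]
    belong to the competing traffic and [W] is the lost time, so [D + W] is the mean blocked
    time. *)
Variables (a b W G D : R).
Hypothesis a_ge0 : 0 <= a.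
Hypothesis W_gt0 : 0 < W.
Hypothesis rho_gt0 : 0 < 1 - a - b.
Hypothesis rho_le : 1 - a - b <= b.
Hypothesis G_ge0 : 0 <= G.
Hypothesis D_ge0 : 0 <= D.
Hypothesis stab_G : a * (G + D + W) <= G.
Hypothesis stab_D : b * (G + D + W) <= D.

(* With U the cycle length and rho = 1 - a - b, stability gives rho U >= W and
   D >= b U; then rho (b U + W)^2 - (1 - a)^2 W U = (rho U - W) (b^2 U - rho W). *)
Let U := G + D + W.
Let rho := 1 - a - b.

Let rhoU : W <= rho * U.
Proof. have := stab_G; have := stab_D; rewrite /rho /U; lra. Qed.

Let U_gt0 : 0 < U.
Proof. have := G_ge0; have := D_ge0; have := W_gt0; rewrite /U; lra. Qed.

Let b_gt0 : 0 < b.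
Proof. have := rho_gt0; have := rho_le; lra. Qed.

Let second_factor : rho * W <= b ^+ 2 * U.
Proof.
have hb := b_gt0; have hr : 0 < rho := rho_gt0; have hrb : rho <= b := rho_le.
have h1 : rho * W <= rho * (rho * U) by rewrite ler_pM2l.
have h2 : rho ^+ 2 * U <= b ^+ 2 * U.
  by rewrite ler_pM2r// ler_pXn2r// nnegrE ltW.
lra.
Qed.

Let key : (b * U + W) ^+ 2 * rho - (1 - a) ^+ 2 * W * U =
  (rho * U - W) * (b ^+ 2 * U - rho * W).
Proof. have -> : a = 1 - b - rho by rewrite /rho; lra. ring. Qed.

Let square_le : (b * U + W) ^+ 2 <= (D + W) ^+ 2.
Proof.
have hD := stab_D; have hb := b_gt0; have hU := U_gt0; have hW := W_gt0.
have h : 0 < b * U by rewrite mulr_gt0.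
rewrite ler_pXn2r ?nnegrE//; rewrite -/U in hD; lra.
Qed.

Lemma cycle_tradeoff : (1 - a) ^+ 2 * W / rho <= (D + W) ^+ 2 / U.
Proof.
have hr : 0 < rho := rho_gt0; have hU := U_gt0.
rewrite ler_pdivrMr// [leRHS]mulrAC ler_pdivlMr//.
have h : (b * U + W) ^+ 2 * rho <= (D + W) ^+ 2 * rho by rewrite ler_pM2r.
apply: le_trans h; rewrite -subr_ge0 key mulr_ge0// subr_ge0//.
Qed.

(** Equality makes the product in [key] vanish. A vanishing second factor together with
    [W < rho * U] would give [b ^+ 2 * U = rho * W < rho ^+ 2 * U], against [rho <= b]; so
    [rho * U = W] in either case, and then [D = b * U]. *)
Lemma cycle_tradeoff_eq : (D + W) ^+ 2 / U <= (1 - a) ^+ 2 * W / rho ->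
  G = a * W / rho /\ D = b * W / rho.
Proof.
have hr : 0 < rho := rho_gt0; have hU := U_gt0; have hW := W_gt0; have hb := b_gt0.
have hrb : rho <= b := rho_le.
rewrite ler_pdivlMr// [leLHS]mulrAC ler_pdivrMr// => h.
have h1 : (b * U + W) ^+ 2 * rho <= (D + W) ^+ 2 * rho by rewrite ler_pM2r.
have f1 : 0 <= rho * U - W by rewrite subr_ge0.
have f2 : 0 <= b ^+ 2 * U - rho * W by rewrite subr_ge0.
have f12 : (rho * U - W) * (b ^+ 2 * U - rho * W) = 0.
  apply/eqP; rewrite eq_le mulr_ge0// andbT -key; lra.
have UE : rho * U = W.
  move/eqP : f12; rewrite mulf_eq0 => /orP[/eqP|/eqP h2]; first lra.
  apply/eqP; rewrite eq_le rhoU andbT leNgt; apply/negP => Wlt.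
  have : rho * W < rho * (rho * U) by rewrite ltr_pM2l.
  have : rho ^+ 2 * U <= b ^+ 2 * U.
    by rewrite ler_pM2r// ler_pXn2r// nnegrE ltW.
  lra.
have sq : (D + W) ^+ 2 <= (b * U + W) ^+ 2.
  rewrite -(ler_pM2r hr); have := key; lra.
have hD := stab_D; rewrite -/U in hD.
have hbU : 0 < b * U by rewrite mulr_gt0.
have DE : D = b * U.
  apply/eqP; rewrite eq_le hD andbT.
  move: sq; rewrite ler_pXn2r ?nnegrE//; lra.
have UE' : U = W / rho by rewrite -UE; field; rewrite gt_eqF.
split; last by rewrite DE UE' mulrA.
have -> : G = (1 - b) * U - W by move: DE; rewrite /U; lra.
rewrite -{1}UE -mulrBl -mulrA -UE'; congr (_ * _); rewrite /rho; lra.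
Qed.

End CycleTradeoff.

(** * One node under a stable policy *)

Section Stable.
Context {R : realType}.
Variables (A : avenue R) (p : policy R) (n : nat).
Hypothesis Y_ge0 : 0 <= yellow_dur A n.
Hypothesis O_ge0 : 0 <= orange_dur A n.
Hypothesis YO_gt0 : 0 < yellow_dur A n + orange_dur A n.
Hypothesis rate0_ge0 : 0 <= rate A 0.
Hypothesis rate0_lt1 : rate A 0 < 1.
Hypothesis rate_ge0 : 0 <= rate A n.
Hypothesis rate_lt1 : rate A n < 1.
Hypothesis node_n : is_node A n.
Hypothesis stable_p : stable A p.

Lemma stable_dur k : (1 <= k)%N -> 0 <= green_dur p n k /\ 0 <= red_dur p n k.
Proof. by case: stable_p => /(_ n node_n)[h _ _] _; exact: h. Qed.

Lemma stable_cvg_green : cvg (cycle_average (green_dur p n) @ \oo).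
Proof. by case: stable_p => /(_ n node_n)[_ h _] _. Qed.

Lemma stable_cvg_red : cvg (cycle_average (red_dur p n) @ \oo).
Proof. by case: stable_p => /(_ n node_n)[_ _ h] _. Qed.

Lemma mean_green_ge0 : 0 <= mean_green p n.
Proof.
apply: limr_ge; first exact: stable_cvg_green.
near=> K; rewrite /cycle_average mulr_ge0 ?invr_ge0// big_add1/= sumr_ge0// => j _.
by case: (@stable_dur j.+1).
Unshelve. all: by end_near. Qed.

Lemma mean_red_ge0 : 0 <= mean_red p n.
Proof.
apply: limr_ge; first exact: stable_cvg_red.
near=> K; rewrite /cycle_average mulr_ge0 ?invr_ge0// big_add1/= sumr_ge0// => j _.
by case: (@stable_dur j.+1).
Unshelve. all: by end_near. Qed.

Let W := yellow_dur A n + orange_dur A n.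

Lemma mean_cycleE : mean_cycle A p n = mean_green p n + mean_red p n + W.
Proof. by rewrite /mean_cycle /W addrA. Qed.

Lemma mean_cycle_gt0 : 0 < mean_green p n + mean_red p n + W.
Proof.
have := mean_green_ge0; have := mean_red_ge0; have : 0 < W := YO_gt0; lra.
Qed.

Lemma stable_green : rate A 0 * (mean_green p n + mean_red p n + W) <= mean_green p n.
Proof.
case: stable_p => _ /(_ n node_n)[h _]; move: h.
by rewrite mean_cycleE ler_pdivlMr// mean_cycle_gt0.
Qed.

Lemma stable_red : rate A n * (mean_green p n + mean_red p n + W) <= mean_red p n.
Proof.
case: stable_p => _ /(_ n node_n)[_ h]; move: h.
by rewrite mean_cycleE ler_pdivlMr// mean_cycle_gt0.
Qed.

Let mN : measurable (nongreen A p n) := measurable_nongreen Y_ge0 O_ge0 stable_dur.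
Let mD : measurable (nonred A p n) := measurable_nonred Y_ge0 O_ge0 stable_dur.

Lemma Psi_funE : Psi A p n = reflected (fun x => rate A n - 1 + \1_(nonred A p n) x).
Proof. by apply/funext => t; exact: Psi_reflected. Qed.

Lemma mean_Psi_ge :
  ((rate A n * (mean_green p n + W) ^+ 2 /
    (2 * (1 - rate A n) * (mean_green p n + mean_red p n + W)))%:E <= mean_Psi A p n)%E.
Proof.
rewrite /mean_Psi Psi_funE.
have -> : mean_green p n + mean_red p n + W = mean_green p n + W + mean_red p n by lra.
apply: (@single_average_ge _ (nonred_len A p n) (red_len p n)) => //.
- by move=> k; exact: nonred_len_ge0 Y_ge0 O_ge0 stable_dur k.
- by move=> k; exact: red_len_ge0 stable_dur k.
- exact: alternates_nonred Y_ge0 O_ge0 stable_dur.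
- exact: nonred_len_mean stable_cvg_green.
- exact: red_len_mean stable_cvg_red.
- by have := mean_cycle_gt0; lra.
Qed.

Lemma Phi1_funE : n = 1%N ->
  Phi A p n = reflected (fun x => rate A 0 - 1 + \1_(nongreen A p n) x).
Proof.
move=> n1; apply/funext => t.
by rewrite /Phi n1/= avenue_queueE//; [rewrite -n1|exact: loc_int_cst].
Qed.

Lemma mean_Phi1_ge : n = 1%N ->
  ((rate A 0 * (mean_red p n + W) ^+ 2 /
    (2 * (1 - rate A 0) * (mean_green p n + mean_red p n + W)))%:E <= mean_Phi A p n)%E.
Proof.
move=> n1; rewrite /mean_Phi Phi1_funE//.
have -> : mean_green p n + mean_red p n + W = mean_red p n + W + mean_green p n by lra.
apply: (@single_average_ge _ (nongreen_len A p n) (green_len p n)) => //.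
- by move=> k; exact: nongreen_len_ge0 Y_ge0 O_ge0 stable_dur k.
- by move=> k; exact: green_len_ge0 stable_dur k.
- exact: alternates_nongreen Y_ge0 O_ge0 stable_dur.
- exact: nongreen_len_mean stable_cvg_red.
- exact: green_len_mean stable_cvg_green.
- by have := mean_cycle_gt0; lra.
Qed.

End Stable.

(** * Regularity of the outflow rates *)

Section Outflow.
Context {R : realType}.
Variables (A : avenue R) (p : policy R).

Lemma outflow_blocked n t : nongreen A p n.+1 t -> outflow A p n.+1 t = 0.
Proof. by move=> h /=; rewrite mem_set. Qed.

Lemma outflow_busy n t : ~ nongreen A p n.+1 t -> 0 < Phi A p n.+1 t ->
  outflow A p n.+1 t = 1.
Proof. by move=> h h2 /=; rewrite memNset// h2. Qed.

Hypothesis rate0_ge0 : 0 <= rate A 0.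
Hypothesis rate0_le1 : rate A 0 <= 1.

(** Induction along the avenue: once the inflow is a [flow], the queue is continuous, so the times
    at which it is positive form an open set and the case distinction defining the outflow is
    measurable. *)
Lemma outflow_flow n : (forall m, (1 <= m <= n)%N -> measurable (nongreen A p m)) ->
  flow (outflow A p n).
Proof.
elim: n => [|n IH] mN; first by apply: flow_cst; rewrite rate0_ge0.
have fl : flow (outflow A p n).
  by apply: IH => m /andP[m1 mn]; apply: mN; rewrite m1 leqW.
have mS : measurable (nongreen A p n.+1) by apply: mN; rewrite ltnS leqnn.
pose Q := avenue_queue (outflow A p n) (nongreen A p n.+1).
have mP : measurable [set t | 0 < Q t].
  have cQ : continuous Q.
    have -> : Q = reflected (fun x => outflow A p n x - 1 + \1_(nongreen A p n.+1) x).
      by apply/funext => t; rewrite /Q avenue_queueE//; exact: flow_loc_int.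
    by apply: reflected_continuous; exact: flow_rate_fun.
  apply: open_measurable.
  have -> : [set t | 0 < Q t] = Q @^-1` [set y | 0 < y] by [].
  by apply: open_comp; [move=> x _; exact: cQ|exact: open_gt].
(* The nested conditionals become [(1 - N) * (1 - (1 - P) * (1 - eta))], with [N] and [P] the
   indicators of non-green and of a positive queue, so that the closure rules of [flow] apply. *)
have -> : outflow A p n.+1 = fun t => (1 - \1_(nongreen A p n.+1) t) *
    (1 - (1 - \1_[set t | 0 < Q t] t) * (1 - outflow A p n t)).
  apply/funext => t /=; rewrite !indicE -/(Q t).
  have [tN|tN] := boolP (t \in nongreen A p n.+1); first by rewrite mulr1n subrr mul0r.
  have [Qt|Qt] := boolP (0 < Q t).
    by rewrite mem_set// mulr0n mulr1n subr0 subrr mul0r subr0 mul1r.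
  rewrite memNset; last exact/negP.
  by rewrite mulr0n subr0 !mul1r opprB addrC subrK.
apply: flowM; first by apply: flow_onem; exact: flow_indic.
apply: flow_onem; apply: flowM; last exact: flow_onem.
by apply: flow_onem; exact: flow_indic.
Qed.

Lemma outflow_open n t : (forall m, (1 <= m <= n)%N -> measurable (nongreen A p m)) ->
  ~ nongreen A p n.+1 t -> outflow A p n t <= outflow A p n.+1 t.
Proof.
move=> mN h /=; rewrite memNset//; case: ifP => // _.
by have /andP[] := proj2 (outflow_flow mN) t.
Qed.

Lemma Phi_funE n : (forall m, (1 <= m <= n.+1)%N -> measurable (nongreen A p m)) ->
  Phi A p n.+1 = reflected (fun x => outflow A p n x - 1 + \1_(nongreen A p n.+1) x).
Proof.
move=> mN; apply/funext => t; rewrite /Phi avenue_queueE//.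
  by apply: mN; rewrite ltnS leqnn.
apply: flow_loc_int; apply: outflow_flow => m /andP[m1 mn].
by apply: mN; rewrite m1 leqW.
Qed.

End Outflow.

Lemma long_run_average_null_density (R : realType) (f : R -> R) : loc_int f ->
  (forall x, 0 <= f x) ->
  (long_run_average f <= 0)%E -> null_density f.
Proof.
move=> If f0 h; apply/cvgrPdist_le => e e0.
have : \forall T \near +oo, cumul f 0 T <= e * T.
  by apply: long_run_average_lt => //; rewrite (le_lt_trans h)// lte_fin.
move=> H; near=> T.
have T0 : 0 < T by near: T; apply: nbhs_pinfty_gt; rewrite ?num_real.
have hT : cumul f 0 T <= e * T by near: T; exact: H.
rewrite sub0r normrN ger0_norm; last first.
  by rewrite mulr_ge0 ?invr_ge0 ?(ltW T0)//; exact: cumul_ge0.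
by rewrite mulrC ler_pdivrMr.
Unshelve. all: by end_near. Qed.

(** * Coincidence of the non-green periods *)

Section Coincidence.
Context {R : realType}.
Variables (A : avenue R) (p : policy R) (Y O G Rd : R).
Hypothesis Y_ge0 : 0 <= Y.
Hypothesis O_ge0 : 0 <= O.
Hypothesis YO_gt0 : 0 < Y + O.
Hypothesis yellow_eq : forall n, is_node A n -> yellow_dur A n = Y.
Hypothesis orange_eq : forall n, is_node A n -> orange_dur A n = O.
Hypothesis rate0_ge0 : 0 <= rate A 0.
Hypothesis rate0_lt1 : rate A 0 < 1.
Hypothesis stable_p : stable A p.
Hypothesis greenE : forall n, is_node A n -> mean_green p n = G.
Hypothesis redE : forall n, is_node A n -> mean_red p n = Rd.
Hypothesis critical : G = rate A 0 * (Rd + (Y + O) + G).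
Hypothesis U_gt0 : 0 < Rd + (Y + O) + G.
Hypothesis Phi1_bounded : exists2 C : R, 0 <= C & (mean_Phi A p 1 < C%:E)%E.
Hypothesis Phi_le0 : forall n, is_node A n -> (2 <= n)%N -> (mean_Phi A p n <= 0)%E.

Let yd n : is_node A n -> 0 <= yellow_dur A n.
Proof. by move=> /yellow_eq ->. Qed.
Let od n : is_node A n -> 0 <= orange_dur A n.
Proof. by move=> /orange_eq ->. Qed.

Lemma measurable_nongreen_node n : is_node A n -> measurable (nongreen A p n).
Proof.
move=> nn; apply: measurable_nongreen; [exact: yd|exact: od|].
exact: stable_dur stable_p.
Qed.

Let mNle n : is_node A n.+1 -> forall m, (1 <= m <= n.+1)%N -> measurable (nongreen A p m).
Proof.
move=> /andP[_ nA] m /andP[m1 mn]; apply: measurable_nongreen_node.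
by rewrite /is_node m1 (leq_trans mn).
Qed.

Let flow_out n : is_node A n.+1 -> flow (outflow A p n.+1).
Proof. by move=> /mNle mN; apply: outflow_flow => //; exact: ltW. Qed.

Let flow_out0 n : is_node A n.+1 -> flow (outflow A p n).
Proof.
move=> /mNle mN; apply: outflow_flow => //; first exact: ltW.
by move=> m /andP[m1 mn]; apply: mN; rewrite m1 leqW.
Qed.

Let B0 n : is_node A n -> forall k, 0 <= nongreen_len A p n k.
Proof. by move=> nn; apply: nongreen_len_ge0;
  [exact: yd|exact: od|exact: stable_dur stable_p]. Qed.
Let D0 n : is_node A n -> forall k, 0 <= green_len p n k.
Proof. by move=> nn; apply: green_len_ge0; exact: stable_dur stable_p. Qed.
Let alt n : is_node A n -> alternates (nongreen_len A p n) (green_len p n) (nongreen A p n).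
Proof. by move=> nn; apply: alternates_nongreen;
  [exact: yd|exact: od|exact: stable_dur stable_p]. Qed.
Let mB n : is_node A n -> (fun K => K%:R^-1 * \sum_(0 <= j < K) nongreen_len A p n j) @ \oo
  --> Rd + (Y + O).
Proof.
move=> nn; rewrite -(redE nn) -(yellow_eq nn) -(orange_eq nn).
by apply: nongreen_len_mean; exact: stable_cvg_red stable_p.
Qed.
Let mG n : is_node A n ->
  (fun K => K%:R^-1 * \sum_(0 <= j < K) green_len p n j) @ \oo --> G.
Proof.
move=> nn; rewrite -(greenE nn).
by apply: green_len_mean; exact: stable_cvg_green stable_p.
Qed.
Let sU n : is_node A n ->
  (fun K => K%:R^-1 * cyc_start (nongreen_len A p n) (green_len p n) K) @ \oo -->
  Rd + (Y + O) + G.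
Proof. by move=> nn; exact: cyc_start_mean (mB nn) (mG nn). Qed.

Let dens n : is_node A n -> (fun T : R => T^-1 * cumul \1_(nongreen A p n) 0 T) @ +oo -->
  (Rd + (Y + O)) / (Rd + (Y + O) + G).
Proof.
move=> nn; apply: (cesaro_blocked_time (B0 nn) (D0 nn)) => //.
- exact: measurable_nongreen_node.
- exact: alt.
- exact: sU.
- exact: mB.
Qed.

Lemma inflow_blocked_null_density n : (1 <= n)%N -> is_node A n.+1 ->
  null_density (fun x => outflow A p n x * \1_(nongreen A p n.+1) x).
Proof.
move=> n1 nn; have fl := flow_out0 nn; have mS := measurable_nongreen_node nn.
apply: (blocked_inflow_null_density (B0 nn) (D0 nn) mS (alt nn) U_gt0 (sU nn) fl).
have ru := flow_rate_fun fl mS.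
apply: long_run_average_null_density; first exact: reflected_loc_int.
  by move=> x; exact: reflected_ge0.
have := Phi_le0 nn n1; rewrite /mean_Phi Phi_funE//; [exact: ltW|exact: mNle].
Qed.

(** Node 1 has constant inflow, so a finite average queue is enough for the critical-load argument.
    Later nodes, whose inflow is not constant, inherit the property from their predecessor. *)
Lemma idle_node n : is_node A n.+1 ->
  null_density (fun x => 1 - \1_(nongreen A p n.+1) x - outflow A p n.+1 x).
Proof.
elim: n => [|n IH] nn.
  have mS := measurable_nongreen_node nn.
  have [C C0 hC] := Phi1_bounded.
  have PhiE := Phi_funE rate0_ge0 (ltW rate0_lt1) (mNle nn).
  have ru := flow_rate_fun (flow_out0 nn) mS.
  apply: (idle_null_density (B0 nn) (D0 nn) mS (alt nn) rate0_ge0 rate0_lt1 (mB nn) (mG nn)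
    U_gt0 critical (flow_out nn) _ _ _ C0).
  - by move=> x; exact: outflow_blocked.
  - move=> x Sx; have := @outflow_open _ A p rate0_ge0 (ltW rate0_lt1) 0 x _ Sx.
    by apply => m /andP[m1 m0]; move: (leq_trans m1 m0).
  - by move=> x Sx Qx; rewrite outflow_busy// PhiE.
  - apply: long_run_average_lt; first exact: (reflected_loc_int ru).
    by move: hC; rewrite /mean_Phi PhiE.
have nn' : is_node A n.+1 by case/andP: nn => _ h; rewrite /is_node (ltnW h).
have hb x : nongreen A p n.+1 x -> outflow A p n.+1 x = 0 by exact: outflow_blocked.
apply: (idle_null_density_next (measurable_nongreen_node nn') (measurable_nongreen_node nn)
  (flow_out nn') hb (IH nn') (inflow_blocked_null_density (ltn0Sn n) nn) (dens nn')
    (dens nn)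
  (flow_out nn)).
- by move=> x; exact: outflow_blocked.
- by move=> x; apply: outflow_open => //; [exact: ltW|exact: mNle].
Qed.

Lemma symdiff_succ_null_density n : (1 <= n)%N -> is_node A n.+1 ->
  null_density \1_(symdiff (nongreen A p n) (nongreen A p n.+1)).
Proof.
case: n => // n _ nn.
have nn' : is_node A n.+1 by case/andP: nn => _ h; rewrite /is_node (ltnW h).
apply: (symdiff_null_density (measurable_nongreen_node nn') (measurable_nongreen_node nn)
  (flow_out nn') _ (idle_node nn') (inflow_blocked_null_density (ltn0Sn n) nn)
    (dens nn') (dens nn)).
by move=> x; exact: outflow_blocked.
Qed.

(** Triangle inequality for symmetric differences along the chain of nodes. *)
Lemma symdiff_node_null_density_le n k : is_node A n -> is_node A (n + k) ->
  null_density \1_(symdiff (nongreen A p n) (nongreen A p (n + k))).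
Proof.
move=> nn; elim: k => [|k IH] nk.
  rewrite addn0; have -> : symdiff (nongreen A p n) (nongreen A p n) = set0.
    by rewrite /symdiff !setDv setU0.
  rewrite indic0; apply: cvg_near_cst; near=> T.
  have T0 : 0 <= T by near: T; apply: nbhs_pinfty_ge; rewrite ?num_real.
  by rewrite (cumul_cst (0 : R) T0) mul0r mulr0.
have n1 : (1 <= n)%N by case/andP: nn.
have nk' : is_node A (n + k).
  case/andP: nk => _; rewrite addnS => h.
  by rewrite /is_node (leq_trans n1 (leq_addr _ _)) ltnW.
have m1 := measurable_nongreen_node nn.
have m2 := measurable_nongreen_node nk'.
have m3 := measurable_nongreen_node nk.
rewrite addnS in nk m3 *.
have ms1 := measurable_symdiff m1 m2; have ms2 := measurable_symdiff m2 m3.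
have ms3 := measurable_symdiff m1 m3.
apply: (@null_density_le _ _ (fun x => \1_(symdiff (nongreen A p n) (nongreen A p (n +
  k))) x +
  \1_(symdiff (nongreen A p (n + k)) (nongreen A p (n + k).+1)) x)).
- exact: loc_int_indic.
- by apply: loc_intD; exact: loc_int_indic.
- by move=> x; have /andP[] := proj2 (flow_indic ms3) x.
- move=> x _; rewrite /symdiff !indicE !in_setU !in_setD.
  case: (x \in nongreen A p n); case: (x \in nongreen A p (n + k));
    case: (x \in nongreen A p (n + k).+1) => /=; rewrite ?mulr1n ?mulr0n; lra.
- apply: null_densityD; [exact: loc_int_indic|exact: loc_int_indic|exact: IH|].
  by apply: symdiff_succ_null_density => //; rewrite (leq_trans n1)// leq_addr.
Unshelve. all: by end_near. Qed.

Lemma symdiff_node_null_density n m : is_node A n -> is_node A m ->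
  null_density \1_(symdiff (nongreen A p n) (nongreen A p m)).
Proof.
wlog nm : n m / (n <= m)%N.
  move=> H nn mm; have [/H|/ltnW/H] := leqP n m; first exact.
  by rewrite /symdiff setUC; exact.
by move=> nn; rewrite -(subnKC nm); exact: symdiff_node_null_density_le.
Qed.

Lemma nongreen_coincide_node n m : is_node A n -> is_node A m ->
  nongreen_coincide A p n m.
Proof.
move=> nn mm; have := symdiff_node_null_density nn mm;
  rewrite /null_density /nongreen_coincide.
have ms := measurable_symdiff (measurable_nongreen_node nn) (measurable_nongreen_node mm).
by under eq_fun do rewrite -time_inE//.
Qed.

(* The lights are right-continuous, so two periodic patterns that differ at one time
   differ on a set of positive density. *)
Lemma nongreen_eq_periodic n m (T0 P : R) : is_node A n -> is_node A m -> 0 <= T0 ->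
  0 < P ->
  eventually_periodic A p T0 P ->
  forall t : R, T0 <= t -> nongreen A p n t <-> nongreen A p m t.
Proof.
move=> nn mm T00 P0 per t T0t.
have hT0 := T00; have t0 := le_trans T00 T0t.
have [y1 [ty1 h1]] := alternates_cover (B0 nn) (D0 nn) (alt nn) U_gt0 (sU nn) t0.
have [y2 [ty2 h2]] := alternates_cover (B0 mm) (D0 mm) (alt mm) U_gt0 (sU mm) t0.
apply: contrapT => diff.
set S := symdiff (nongreen A p n) (nongreen A p m).
have mS : measurable S.
  by apply: measurable_symdiff; exact: measurable_nongreen_node.
(* Both lights keep their colour on [[t, t + e[], and [e <= P] keeps the translates of this window
   by multiples of [P] disjoint. *)
pose e := Num.min P (Num.min (y1 - t) (y2 - t)).
have e0 : 0 < e by rewrite !lt_min P0 !subr_gt0 ty1 ty2.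
have eP : e <= P by rewrite ge_min lexx.
have e1 : e <= y1 - t by rewrite !ge_min lexx orbT.
have e2 : e <= y2 - t by rewrite !ge_min lexx !orbT.
have St x : t <= x < t + e -> ~ (nongreen A p n x <-> nongreen A p m x).
  move=> /andP[tx xe] iff; apply: diff.
  have hx1 := h1 x; have hx2 := h2 x.
  have [] : (t <= x < y1) /\ (t <= x < y2) by split; lra.
  by move=> /hx1 <- /hx2 <-.
have Sj j x : t + j%:R * P <= x < t + j%:R * P + e ->
    ~ (nongreen A p n x <-> nongreen A p m x).
  elim: j x => [|j IH] x; first by rewrite mul0r addr0; exact: St.
  move=> hx; have jP : 0 <= j%:R * P by rewrite mulr_ge0// ltW.
  have hx' : t + j%:R * P <= x - P < t + j%:R * P + e.
    by move: hx; rewrite -natr1; lra.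
  have hT : T0 <= x - P by lra.
  have := IH _ hx'; have := per _ nn _ hT; have := per _ mm _ hT; rewrite subrK.
  tauto.
have IS := loc_int_indic mS.
have S1 x : ~ (nongreen A p n x <-> nongreen A p m x) -> S x.
  rewrite /S /symdiff /=; have [] := pselect (nongreen A p n x);
  have [] := pselect (nongreen A p m x); tauto.
have cumul_S_ge0 a b : 0 <= cumul \1_S a b.
  by apply: cumul_ge0 => x _; have /andP[] := proj2 (flow_indic mS) x.
have low j : j%:R * e <= cumul \1_S 0 (t + j%:R * P).
  elim: j => [|j IH]; first by rewrite mul0r.
  have jP : 0 <= j%:R * P by rewrite mulr_ge0// ltW.
  have i1 : 0 <= t + j%:R * P by rewrite addr_ge0.
  have i2 : t + j%:R * P <= t + j%:R * P + e by rewrite lerDl ltW.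
  have i3 : t + j%:R * P + e <= t + j.+1%:R * P by rewrite -natr1; lra.
  rewrite (cumul_split IS i1 (le_trans i2 i3)) (cumul_split IS i2 i3).
  have : 1 * (t + j%:R * P + e - (t + j%:R * P)) <=
      cumul \1_S (t + j%:R * P) (t + j%:R * P + e).
    rewrite -cumul_cst//; apply: cumul_le => //; first exact: loc_int_cst.
    move=> x /andP[tx xe]; rewrite indicE mem_set//; apply: S1; apply: (Sj j).
    by rewrite (ltW tx).
  have := cumul_S_ge0 (t + j%:R * P + e) (t + j.+1%:R * P).
  rewrite -natr1; lra.
have neg := symdiff_node_null_density nn mm; rewrite -/S in neg.
(* The windows have density [e / P]. For [j] large enough that [j * P] exceeds [|M| + t], the time
   [t + j * P] is past [M] and at most [2 * j * P], so the level [e / (4 * P)] allows at most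
   [j * e / 2], half of what the windows fill. *)
have eP0 : 0 < e / (4 * P) by rewrite divr_gt0// mulr_gt0.
have [M [_ HM]] : \forall T \near +oo, `|0 - T^-1 * cumul \1_S 0 T| <= e / (4 * P).
  by move/cvgrPdist_le : neg; exact.
have [j hj] : exists j : nat, (`|M| + t) / P < j%:R.
  by exists (Num.truncn ((`|M| + t) / P)).+1; exact: truncnS_gt.
rewrite ltr_pdivrMr// in hj.
have MT : M < t + j%:R * P by have := ler_norm M; lra.
have T_gt0 : 0 < t + j%:R * P.
  by have := normr_ge0 M; lra.
have := HM _ MT; rewrite sub0r normrN ger0_norm; last first.
  by rewrite mulr_ge0// invr_ge0 ltW.
rewrite mulrC ler_pdivrMr// => hup.
have hlow := low j.
have hT2 : t + j%:R * P <= 2 * (j%:R * P) by have := normr_ge0 M; lra.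
have : e / (4 * P) * (t + j%:R * P) <= e / (4 * P) * (2 * (j%:R * P)).
  by rewrite ler_pM2l.
have -> : e / (4 * P) * (2 * (j%:R * P)) = j%:R * e / 2 by field; rewrite gt_eqF.
have j0 : 0 < j%:R * e.
  rewrite mulr_gt0//; have := normr_ge0 M => hM0.
  have : 0 < j%:R * P by lra.
  by rewrite pmulr_lgt0.
lra.
Qed.

End Coincidence.

(** * Queues under the greenwave policy *)

Section Greenwave.
Context {R : realType}.
Variables (A : avenue R) (Y O delta : R).
Hypothesis nodes_gt0 : (1 <= nodes A)%N.
Hypothesis rate0_ge0 : 0 <= rate A 0.
Hypothesis rate_ge0 : forall n, is_node A n -> 0 <= rate A n.
Hypothesis load_lt1 : forall n, is_node A n -> rate A 0 + rate A n < 1.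
Hypothesis Y_ge0 : 0 <= Y.
Hypothesis O_ge0 : 0 <= O.
Hypothesis YO_gt0 : 0 < Y + O.
Hypothesis yellow_eq : forall n, is_node A n -> yellow_dur A n = Y.
Hypothesis orange_eq : forall n, is_node A n -> orange_dur A n = O.
Hypothesis rate_eq : forall n, is_node A n -> rate A n = rate A 1.
Hypothesis delta_ge0 : 0 <= delta.

Let gw := greenwave A Y O delta.
Let a := rate A 0.
Let b := rate A 1.

Let node1 : is_node A 1.
Proof. by rewrite /is_node nodes_gt0. Qed.

Let a_ge0 : 0 <= a. Proof. exact: rate0_ge0. Qed.
Let b_ge0 : 0 <= b. Proof. exact: rate_ge0. Qed.
Let ab_lt1 : a + b < 1. Proof. exact: load_lt1. Qed.

Lemma max_rateE : max_rate A = rate A 1.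
Proof.
rewrite /max_rate big_nat; apply: (big_ind (fun x => x = rate A 1)); first by [].
  by move=> x y -> ->; exact: maxxx.
move=> n /andP[n1 nN]; by apply: rate_eq; rewrite /is_node n1.
Qed.

Let g := a * (1 + delta) * (Y + O) / (1 - a - b).
Let r := b * (1 + delta) * (Y + O) / (1 - a - b).

Lemma greenwave_greenE : greenwave_green A Y O delta = g.
Proof. by rewrite /greenwave_green max_rateE. Qed.

Lemma greenwave_redE : greenwave_red A Y O delta = r.
Proof. by rewrite /greenwave_red max_rateE. Qed.

Let rho_gt0 : 0 < 1 - a - b.
Proof. have := ab_lt1; lra. Qed.

Let g_ge0 : 0 <= g.
Proof.
have := a_ge0; have := delta_ge0; have := rho_gt0; have := YO_gt0 => *.
rewrite /g divr_ge0 ?mulr_ge0//; lra.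
Qed.

Let r_ge0 : 0 <= r.
Proof.
have := b_ge0; have := delta_ge0; have := rho_gt0; have := YO_gt0 => *.
rewrite /r divr_ge0 ?mulr_ge0//; lra.
Qed.

Lemma cycle_average_cst (c : R) : cycle_average (fun=> c) @ \oo --> c.
Proof.
apply: cvg_near_cst; near=> K.
have K0 : (K%:R : R) != 0 by rewrite pnatr_eq0 -lt0n; near: K; exact: nbhs_infty_gt.
by rewrite /cycle_average big_add1/= sumr_const_nat subn0 -[X in _^-1 * X]mulr_natl mulrA mulVf// mul1r.
Unshelve. all: by end_near. Qed.

Lemma mean_green_gw n : mean_green gw n = g.
Proof.
rewrite /mean_green /gw /= greenwave_greenE; apply/cvg_lim => //.
exact: cycle_average_cst.
Qed.

Lemma mean_red_gw n : mean_red gw n = r.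
Proof.
rewrite /mean_red /gw /= greenwave_redE; apply/cvg_lim => //.
exact: cycle_average_cst.
Qed.

Let U_eq : g + r + (Y + O) = (Y + O) * (1 + delta * (a + b)) / (1 - a - b).
Proof. by rewrite /g /r; field; rewrite gt_eqF. Qed.

Let d_gt0 : 0 < 1 + delta * (a + b).
Proof.
have := a_ge0; have := b_ge0 => h1 h2.
by rewrite ltr_wpDr// mulr_ge0// addr_ge0.
Qed.

Let U_gt0 : 0 < g + r + (Y + O).
Proof. by rewrite U_eq divr_gt0// mulr_gt0. Qed.

(** The value is [delta * (Y + O)], kept uncancelled for its uses: green exceeds its required share
    of the cycle by [a] times it and red by [b] times it. At [delta = 0] both stability conditions
    are equalities. *)
Let slack : 0 <= delta * (1 - a - b) * (Y + O) / (1 - a - b).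
Proof.
by rewrite divr_ge0 ?(ltW rho_gt0)// !mulr_ge0 ?(ltW rho_gt0)// ltW.
Qed.

Let stable_g : a * (g + r + (Y + O)) <= g.
Proof.
rewrite -subr_ge0.
have -> : g - a * (g + r + (Y + O)) = a * (delta * (1 - a - b) * (Y + O) / (1 - a - b)).
  by rewrite /g /r; field; rewrite gt_eqF.
by rewrite mulr_ge0.
Qed.

Let stable_r : b * (g + r + (Y + O)) <= r.
Proof.
rewrite -subr_ge0.
have -> : r - b * (g + r + (Y + O)) = b * (delta * (1 - a - b) * (Y + O) / (1 - a - b)).
  by rewrite /g /r; field; rewrite gt_eqF.
by rewrite mulr_ge0.
Qed.

Lemma greenwave_stable : stable A gw.
Proof.
split=> [n nn|n nn].
  split.
  - by move=> k _; rewrite /gw /= greenwave_greenE greenwave_redE.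
  - by apply/cvg_ex; exists g; rewrite /gw/= greenwave_greenE; exact: cycle_average_cst.
  - by apply/cvg_ex; exists r; rewrite /gw/= greenwave_redE; exact: cycle_average_cst.
have UE : mean_cycle A gw n = g + r + (Y + O).
  by rewrite /mean_cycle mean_green_gw mean_red_gw yellow_eq// orange_eq// addrA.
rewrite UE mean_green_gw mean_red_gw (rate_eq nn).
by split; rewrite ler_pdivlMr.
Qed.

Let yd n : is_node A n -> 0 <= yellow_dur A n.
Proof. by move=> /yellow_eq ->. Qed.
Let od n : is_node A n -> 0 <= orange_dur A n.
Proof. by move=> /orange_eq ->. Qed.
Let du n : is_node A n -> forall k, (1 <= k)%N ->
  0 <= green_dur gw n k /\ 0 <= red_dur gw n k.
Proof. by move=> nn; exact: (stable_dur nn greenwave_stable). Qed.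
Let yod n : is_node A n -> 0 < yellow_dur A n + orange_dur A n.
Proof. by move=> nn; rewrite yellow_eq// orange_eq. Qed.

Let a_lt1 : a < 1. Proof. have := ab_lt1; have := b_ge0; lra. Qed.
Let b_lt1 : b < 1. Proof. have := ab_lt1; have := a_ge0; lra. Qed.

(** The universal lower bound is exact here: durations are constant, and stability then says that
    each red period empties the queue, which is the hypothesis of [drained_average_le]. *)
Lemma mean_Psi_gw n : is_node A n -> mean_Psi A gw n =
  (b * (1 + a * delta - b) ^+ 2 * (Y + O) /
    (2 * (1 - b) * (1 - a - b) * (1 + delta * (a + b))))%:E.
Proof.
move=> nn; have bE := rate_eq nn; rewrite -/b in bE.
have e : b * (g + (Y + O)) ^+ 2 / (2 * (1 - b) * (g + r + (Y + O))) =
    b * (1 + a * delta - b) ^+ 2 * (Y + O) /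
    (2 * (1 - b) * (1 - a - b) * (1 + delta * (a + b))).
  rewrite U_eq /g; have := b_lt1; rewrite -subr_gt0 => ?.
  by field; rewrite !gt_eqF.
apply/eqP; rewrite eq_le; apply/andP; split; last first.
  have := mean_Psi_ge (yd nn) (od nn) (yod nn) _ _ nn greenwave_stable.
  rewrite mean_green_gw mean_red_gw yellow_eq// orange_eq// bE e; apply => //.
rewrite -e /mean_Psi (Psi_funE (yd nn) (od nn) nn greenwave_stable) bE.
have hY := Y_ge0; have hO := O_ge0; have hg := g_ge0; have hr := r_ge0.
have hb := b_lt1.
apply: (@drained_average_le _ (nonred_len A gw n) (red_len gw n)) => //.
- by move=> k; exact: nonred_len_ge0 (yd nn) (od nn) (du nn) k.
- by move=> k; exact: red_len_ge0 (du nn) k.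
- exact: measurable_nonred (yd nn) (od nn) (du nn).
- exact: alternates_nonred (yd nn) (od nn) (du nn).
(* The opening blocked period has length [Y], at most that of the others, so the bound for a regular
   period covers it too. *)
- move=> k; apply: (@le_trans _ _ (b * (g + (Y + O)))).
    rewrite ler_wpM2l//; case: k => [|k]/=; rewrite yellow_eq//; first lra.
    by rewrite orange_eq// /gw/= greenwave_greenE; lra.
  rewrite /red_len /gw /= greenwave_redE; have := stable_r; lra.
- case=> [|k] /=; rewrite yellow_eq//; first lra.
  by rewrite orange_eq// /gw/= greenwave_greenE; lra.
- case=> // k _; rewrite /= yellow_eq// orange_eq// /red_len /gw/=.
  by rewrite greenwave_greenE greenwave_redE; lra.
Qed.

Lemma mean_Phi1_gw : mean_Phi A gw 1 =
  (a * (1 - a + delta * b) ^+ 2 * (Y + O) /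
    (2 * (1 - a) * (1 - a - b) * (1 + delta * (a + b))))%:E.
Proof.
have nn := node1.
have e : a * (r + (Y + O)) ^+ 2 / (2 * (1 - a) * (g + r + (Y + O))) =
    a * (1 - a + delta * b) ^+ 2 * (Y + O) /
    (2 * (1 - a) * (1 - a - b) * (1 + delta * (a + b))).
  rewrite U_eq /r; have := a_lt1; rewrite -subr_gt0 => ?.
  by field; rewrite !gt_eqF.
apply/eqP; rewrite eq_le; apply/andP; split; last first.
  have := mean_Phi1_ge (yd nn) (od nn) (yod nn) _ _ nn greenwave_stable erefl.
  rewrite mean_green_gw mean_red_gw yellow_eq// orange_eq// e; apply => //.
rewrite -e /mean_Phi (Phi1_funE (yd nn) (od nn) nn greenwave_stable)//.
have hY := Y_ge0; have hO := O_ge0; have hg := g_ge0; have hr := r_ge0.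
have BE k : nongreen_len A gw 1 k = r + (Y + O).
  by rewrite /nongreen_len yellow_eq// orange_eq// /gw/= greenwave_redE; lra.
have DE k : green_len gw 1 k = g by rewrite /green_len /gw/= greenwave_greenE.
apply: (@drained_average_le _ (nongreen_len A gw 1) (green_len gw 1)) => //.
- by move=> k; exact: nongreen_len_ge0 (yd nn) (od nn) (du nn) k.
- by move=> k; exact: green_len_ge0 (du nn) k.
- exact: measurable_nongreen (yd nn) (od nn) (du nn).
- exact: alternates_nongreen (yd nn) (od nn) (du nn).
- by move=> k; rewrite BE DE; have := stable_g; rewrite /a; lra.
- by move=> k; rewrite BE.
- by move=> k _; rewrite BE DE; lra.
Qed.

Lemma nongreen_gw n m : is_node A n -> is_node A m ->
  nongreen A gw n = nongreen A gw m.
Proof.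
move=> nn mm.
rewrite (nongreenE (yd nn) (od nn) (du nn)) (nongreenE (yd mm) (od mm) (du mm)).
by congr blocked_set; apply/funext => k; rewrite /nongreen_len !yellow_eq// !orange_eq.
Qed.

(* With synchronized lights, avenue fluid only reaches a node while it is green. *)
Lemma mean_Phi_gw n : is_node A n -> (2 <= n)%N -> mean_Phi A gw n = 0%E.
Proof.
case: n => [|[|n]]// nn _.
have nn' : is_node A n.+1 by case/andP: nn => _ h; rewrite /is_node (ltnW h).
have mN m : (1 <= m <= n.+2)%N -> measurable (nongreen A gw m).
  move=> /andP[m1 mn].
  have mm : is_node A m by case/andP: nn => _ h; rewrite /is_node m1 (leq_trans mn).
  exact: measurable_nongreen (yd mm) (od mm) (du mm).
have fl : flow (outflow A gw n.+1).
  apply: outflow_flow => //; first exact: ltW a_lt1.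
  by move=> m /andP[m1 mn]; apply: mN; rewrite m1 leqW.
have mS : measurable (nongreen A gw n.+2) by apply: mN; rewrite leqnn.
have ru := flow_rate_fun fl mS.
apply/eqP; rewrite eq_le; apply/andP; split; last first.
  apply: long_run_average_ge0 => x.
  by rewrite Phi_funE//; [exact: reflected_ge0|exact: ltW a_lt1].
rewrite /mean_Phi Phi_funE//; last exact: ltW a_lt1.
set u := (fun x => _ - 1 + _).
have u_le x : u x <= 0.
  rewrite /u indicE; have [Sx|Sx] := pselect (nongreen A gw n.+2 x).
    by rewrite mem_set// outflow_blocked ?(nongreen_gw nn' nn)// mulr1n; lra.
  by rewrite memNset// mulr0n; have /andP[] := proj2 fl x; lra.
have u_cumul_le c t : c <= t -> cumul u c t <= 0.
  move=> ct; rewrite -(mul0r (t - c)) -cumul_cst//; apply: cumul_le;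
    [by case: ru|exact: loc_int_cst|].
  by move=> x _; exact: u_le.
have Q0 t : 0 <= t -> reflected u t <= 0.
  move=> t0; apply: (reflected_le ru (lexx 0) t0).
    by rewrite reflected_neg// add0r u_cumul_le.
  by move=> c /andP[_ ct]; exact: u_cumul_le.
apply: long_run_average_le; first exact: reflected_loc_int.
near=> T; have T0 : 0 <= T by near: T; apply: nbhs_pinfty_ge; rewrite ?num_real.
have -> : (0 : R) * T = 0 * (T - 0) by rewrite !mul0r.
rewrite -cumul_cst//; apply: cumul_le; [exact: reflected_loc_int|exact: loc_int_cst|].
by move=> x /andP[x0 _]; apply: Q0; exact: ltW.
Unshelve. all: by end_near. Qed.

End Greenwave.

(** * Lower bounds for all stable policies *)

Section Bounds.
Context {R : realType}.
Variables (A : avenue R) (Y O : R).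
Hypothesis nodes_gt0 : (1 <= nodes A)%N.
Hypothesis rate0_ge0 : 0 <= rate A 0.
Hypothesis rate_ge0 : forall n, is_node A n -> 0 <= rate A n.
Hypothesis load_lt1 : forall n, is_node A n -> rate A 0 + rate A n < 1.
Hypothesis Y_ge0 : 0 <= Y.
Hypothesis O_ge0 : 0 <= O.
Hypothesis YO_gt0 : 0 < Y + O.
Hypothesis yellow_eq : forall n, is_node A n -> yellow_dur A n = Y.
Hypothesis orange_eq : forall n, is_node A n -> orange_dur A n = O.
Hypothesis rate_eq : forall n, is_node A n -> rate A n = rate A 1.
Hypothesis load1 : 1 <= rate A 0 + 2 * rate A 1.
Hypothesis load2 : 1 <= 2 * rate A 0 + rate A 1.

Let l0 := rate A 0.
Let l1 := rate A 1.
Let node1 : is_node A 1.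
Proof. by rewrite /is_node nodes_gt0. Qed.

Let rho_gt0 : 0 < 1 - l0 - l1.
Proof. have := load_lt1 node1; rewrite /l0 /l1; lra. Qed.
Let rho_gt0' : 0 < 1 - l1 - l0.
Proof. have := rho_gt0; lra. Qed.
Let rho_le1 : 1 - l0 - l1 <= l1.
Proof. have := load1; rewrite /l0 /l1; lra. Qed.
Let rho_le0 : 1 - l1 - l0 <= l0.
Proof. have := load2; rewrite /l0 /l1; lra. Qed.
Let l0_gt0 : 0 < l0.
Proof. have := rho_gt0; have := rho_le0; lra. Qed.
Let l1_gt0 : 0 < l1.
Proof. have := rho_gt0; have := rho_le1; lra. Qed.
Let l0_lt1 : l0 < 1.
Proof. have := rho_gt0; have := l1_gt0; lra. Qed.
Let l1_lt1 : l1 < 1.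
Proof. have := rho_gt0; have := l0_gt0; lra. Qed.

(** [cycle_tradeoff] with the avenue as the measured traffic. Attaining the bound fixes the red mean
    as well as the green one. *)
Lemma Phi1_lower_bound p : stable A p ->
  ((l0 * (1 - l0) ^+ 2 * (Y + O) / (2 * (1 - l0) * (1 - l0 - l1)))%:E <=
    mean_Phi A p 1)%E /\
  ((mean_Phi A p 1 <= (l0 * (1 - l0) ^+ 2 * (Y +
    O) / (2 * (1 - l0) * (1 - l0 - l1)))%:E)%E ->
   mean_green p 1 = l0 * (Y + O) / (1 - l0 - l1) /\
   mean_red p 1 = l1 * (Y + O) / (1 - l0 - l1)).
Proof.
move=> st; have nn := node1.
have h0 := rho_gt0; have hl0 := l0_lt1; have hl1 := l1_lt1; have hp0 := l0_gt0.
have yd : 0 <= yellow_dur A 1 by rewrite yellow_eq.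
have od : 0 <= orange_dur A 1 by rewrite orange_eq.
have yod : 0 < yellow_dur A 1 + orange_dur A 1 by rewrite yellow_eq// orange_eq.
have U0 := mean_cycle_gt0 yod nn st; rewrite yellow_eq// orange_eq// in U0.
have sg := stable_green yod nn st; rewrite yellow_eq// orange_eq// in sg.
have sr := stable_red yod nn st; rewrite yellow_eq// orange_eq// in sr.
have g0 := mean_green_ge0 nn st; have r0 := mean_red_ge0 nn st.
have k0 : 0 < l0 / (2 * (1 - l0)) by rewrite divr_gt0// mulr_gt0// subr_gt0.
have E1 : l0 * (1 - l0) ^+ 2 * (Y + O) / (2 * (1 - l0) * (1 - l0 - l1)) =
    l0 / (2 * (1 - l0)) * ((1 - l0) ^+ 2 * (Y + O) / (1 - l0 - l1)).
  by field; rewrite !gt_eqF// subr_gt0.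
have := mean_Phi1_ge yd od yod rate0_ge0 hl0 nn st erefl.
rewrite yellow_eq// orange_eq//.
have -> : rate A 0 * (mean_red p 1 + (Y + O)) ^+ 2 /
    (2 * (1 - rate A 0) * (mean_green p 1 + mean_red p 1 + (Y + O))) =
    l0 / (2 * (1 - l0)) *
    ((mean_red p 1 + (Y + O)) ^+ 2 / (mean_green p 1 + mean_red p 1 + (Y + O))).
  by rewrite -/l0; field; rewrite !gt_eqF// subr_gt0.
move=> low; split.
  apply: le_trans low; rewrite lee_fin E1 ler_pM2l//.
  by apply: cycle_tradeoff => //; exact: ltW.
move=> up; have := le_trans low up; rewrite lee_fin E1 ler_pM2l//.
by apply: cycle_tradeoff_eq => //; exact: ltW.
Qed.

(** [cycle_tradeoff] with avenue and cross traffic exchanged, whence the reordered sums. Attaining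
    the bound fixes both means at node [n], which later gives the means at every node from the cross
    queues. *)
Lemma Psi_lower_bound p n : stable A p -> is_node A n ->
  ((l1 * (1 - l1) ^+ 2 * (Y + O) / (2 * (1 - l1) * (1 - l0 - l1)))%:E <=
    mean_Psi A p n)%E /\
  ((mean_Psi A p n <= (l1 * (1 - l1) ^+ 2 * (Y +
    O) / (2 * (1 - l1) * (1 - l0 - l1)))%:E)%E ->
   mean_green p n = l0 * (Y + O) / (1 - l0 - l1) /\
   mean_red p n = l1 * (Y + O) / (1 - l0 - l1)).
Proof.
move=> st nn; have bE := rate_eq nn; rewrite -/l1 in bE.
have h0 := rho_gt0; have h0' := rho_gt0'.
have hl0 := l0_lt1; have hl1 := l1_lt1; have hp0 := l0_gt0; have hp1 := l1_gt0.
have yd : 0 <= yellow_dur A n by rewrite yellow_eq.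
have od : 0 <= orange_dur A n by rewrite orange_eq.
have yod : 0 < yellow_dur A n + orange_dur A n by rewrite yellow_eq// orange_eq.
have U0 := mean_cycle_gt0 yod nn st; rewrite yellow_eq// orange_eq// in U0.
have sg := stable_green yod nn st; rewrite yellow_eq// orange_eq// in sg.
have sr := stable_red yod nn st; rewrite yellow_eq// orange_eq// bE in sr.
have g0 := mean_green_ge0 nn st; have r0 := mean_red_ge0 nn st.
rewrite [mean_green p n + _]addrC in U0 sg sr.
have k0 : 0 < l1 / (2 * (1 - l1)) by rewrite divr_gt0// mulr_gt0// subr_gt0.
have -> : 1 - l0 - l1 = 1 - l1 - l0 by lra.
have E1 : l1 * (1 - l1) ^+ 2 * (Y + O) / (2 * (1 - l1) * (1 - l1 - l0)) =
    l1 / (2 * (1 - l1)) * ((1 - l1) ^+ 2 * (Y + O) / (1 - l1 - l0)).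
  by field; rewrite !gt_eqF// subr_gt0.
have := mean_Psi_ge yd od yod _ _ nn st.
rewrite bE yellow_eq// orange_eq//.
have -> : l1 * (mean_green p n + (Y + O)) ^+ 2 /
    (2 * (1 - l1) * (mean_green p n + mean_red p n + (Y + O))) =
    l1 / (2 * (1 - l1)) *
    ((mean_green p n + (Y + O)) ^+ 2 / (mean_red p n + mean_green p n + (Y + O))).
  rewrite [mean_green p n + mean_red p n]addrC.
  by field; rewrite !gt_eqF// subr_gt0.
move=> /(_ (ltW hp1) hl1) low; split.
  apply: le_trans low; rewrite lee_fin E1 ler_pM2l//.
  by apply: cycle_tradeoff => //; exact: ltW.
move=> up; have := le_trans low up; rewrite lee_fin E1 ler_pM2l//.
move=> h; apply/and_comm; move: h.
by apply: cycle_tradeoff_eq => //; exact: ltW.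
Qed.

Lemma mean_Phi_ge0 p n : stable A p -> is_node A n -> (0 <= mean_Phi A p n)%E.
Proof.
case: n => // n st nn; apply: long_run_average_ge0 => x.
have mN m : (1 <= m <= n.+1)%N -> measurable (nongreen A p m).
  move=> /andP[m1 mn]; case/andP: nn => _ nN.
  have mm : is_node A m by rewrite /is_node m1 (leq_trans mn).
  apply: measurable_nongreen; rewrite ?yellow_eq ?orange_eq//.
  exact: (stable_dur mm st).
have a1 : rate A 0 <= 1 by exact: ltW l0_lt1.
rewrite Phi_funE//; apply: reflected_ge0; apply: flow_rate_fun.
  by apply: outflow_flow => // m /andP[m1 mn]; apply: mN; rewrite m1 leqW.
by apply: mN; rewrite leqnn.
Qed.

End Bounds.

(** The common form of both greenwave averages as functions of [delta = x]. *)
Lemma cvg_quotient_at_right0 (R : realType) (c k e w d f : R) : d != 0 ->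
  (c * (k + x * e) ^+ 2 * w / (d * (1 + x * f)))%:E @[x --> 0^'+] -->
  (c * k ^+ 2 * w / d)%:E.
Proof.
move=> d0; apply: cvg_EFin; first by near=> x.
apply: cvg_at_right_filter.
have lin (y z : R) : (fun x => y + x * z) @ 0 --> y + 0 * z.
  by apply: cvgD; [exact: cvg_cst|apply: cvgM; [exact: cvg_id|exact: cvg_cst]].
have h : (fun x => c * ((k + x * e) * (k + x * e)) * w * (d * (1 + x * f))^-1) @ 0 -->
    c * ((k + 0 * e) * (k + 0 * e)) * w * (d * (1 + 0 * f))^-1.
  apply: cvgM.
    apply: cvgM; last exact: cvg_cst.
    by apply: cvgM; [exact: cvg_cst|apply: cvgM; exact: lin].
  apply: cvgV; first by rewrite mul0r addr0 mulr1.
  by apply: cvgM; [exact: cvg_cst|exact: lin].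
by move: h; rewrite !mul0r !addr0 mulr1.
Unshelve. all: by end_near. Qed.

(** * The bounds compared with the greenwave policy *)

Unset Implicit Arguments.

Theorem mainTheorem1 (R : realType) (A : avenue R) (Y O : R)
  (nodes_gt0 : (1 <= nodes A)%N)
  (rate0_ge0 : 0 <= rate A 0)
  (rate_ge0 : forall n, is_node A n -> 0 <= rate A n)
  (load_lt1 : forall n, is_node A n -> rate A 0 + rate A n < 1)
  (Y_ge0 : 0 <= Y) (O_ge0 : 0 <= O) (YO_gt0 : 0 < Y + O)
  (yellow_eq : forall n, is_node A n -> yellow_dur A n = Y)
  (orange_eq : forall n, is_node A n -> orange_dur A n = O)
  (rate_eq : forall n, is_node A n -> rate A n = rate A 1)
  (load1 : 1 <= rate A 0 + 2 * rate A 1)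
  (load2 : 1 <= 2 * rate A 0 + rate A 1) :
  let l0 := rate A 0 in
  let l1 := rate A 1 in
  let Phi_bound :=
    l0 * (1 - l0) ^+ 2 * (Y + O) / (2 * (1 - l0) * (1 - l0 - l1)) in
  let Psi_bound :=
    l1 * (1 - l1) ^+ 2 * (Y + O) / (2 * (1 - l1) * (1 - l0 - l1)) in
  let G_opt := l0 * (Y + O) / (1 - l0 - l1) in
  let R_opt := l1 * (Y + O) / (1 - l0 - l1) in
  let gw := greenwave A Y O in
  (* queue lengths under the greenwave policy *)
  [/\ forall delta, 0 <= delta ->
      [/\ stable A (gw delta),
          mean_Phi A (gw delta) 1 =
            (l0 * (1 - l0 + delta * l1) ^+ 2 * (Y + O) /
              (2 * (1 - l0) * (1 - l0 - l1) * (1 + delta * (l0 + l1))))%:E,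
          forall n, is_node A n -> mean_Psi A (gw delta) n =
            (l1 * (1 + l0 * delta - l1) ^+ 2 * (Y + O) /
              (2 * (1 - l1) * (1 - l0 - l1) * (1 + delta * (l0 + l1))))%:E &
          forall n, is_node A n -> (2 <= n)%N -> mean_Phi A (gw delta) n = 0%E],
  (* (i) *)
      forall p, stable A p ->
      [/\ (Phi_bound%:E <= mean_Phi A p 1)%E,
          mean_green p 1 <> G_opt -> (Phi_bound%:E < mean_Phi A p 1)%E &
          forall n, is_node A n ->
            (Psi_bound%:E <= mean_Psi A p n)%E /\
            (mean_red p n <> R_opt -> (Psi_bound%:E < mean_Psi A p n)%E)],
  (* (ii) *)
      [/\ mean_Phi A (gw delta) 1 @[delta --> 0^'+] --> Phi_bound%:E,
          forall n, is_node A n ->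
            mean_Psi A (gw delta) n @[delta --> 0^'+] --> Psi_bound%:E,
          forall q, stable A q -> forall n, is_node A n ->
            (lim (mean_Phi A (gw delta) n @[delta --> 0^'+]) <= mean_Phi A q n)%E /\
            (lim (mean_Psi A (gw delta) n @[delta --> 0^'+]) <= mean_Psi A q n)%E &
          optimal A (gw 0)] &
  (* (iii) *)
      [/\ G_opt = greenwave_green A Y O 0,
          R_opt = greenwave_red A Y O 0 &
          forall p, optimal A p ->
          [/\ forall n, is_node A n -> mean_green p n = G_opt /\ mean_red p n = R_opt,
              forall n m, is_node A n -> is_node A m -> nongreen_coincide A p n m &
              forall T0 P, 0 <= T0 -> 0 < P -> eventually_periodic A p T0 P ->
                forall n m, is_node A n -> is_node A m ->
                forall t, T0 <= t -> nongreen A p n t <-> nongreen A p m t]]].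
Proof.
move=> l0 l1 Phi_bound Psi_bound G_opt R_opt gw.
have node1 : is_node A 1 by rewrite /is_node nodes_gt0.
have rho_gt0 : 0 < 1 - l0 - l1 by have := load_lt1 1%N node1; rewrite -/l0 -/l1; lra.
have h1 : 1 <= l0 + 2 * l1 by exact: load1.
have h2 : 1 <= 2 * l0 + l1 by exact: load2.
have l0_gt0 : 0 < l0 by lra.
have l1_gt0 : 0 < l1 by lra.
have l0_lt1 : 0 < 1 - l0 by lra.
have l1_lt1 : 0 < 1 - l1 by lra.
have lt1 : rate A 0 < 1 by rewrite -subr_gt0.
have lbPhi := @Phi1_lower_bound _ _ _ _ nodes_gt0 rate0_ge0 load_lt1 Y_ge0 O_ge0
  YO_gt0 yellow_eq orange_eq load1 load2.
have lbPsi := @Psi_lower_bound _ _ _ _ nodes_gt0 load_lt1 Y_ge0 O_ge0 YO_gt0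
  yellow_eq orange_eq rate_eq load1 load2.
rewrite -/l0 -/l1 -/Phi_bound -/G_opt -/R_opt in lbPhi.
rewrite -/l0 -/l1 -/Psi_bound -/G_opt -/R_opt in lbPsi.
have Phi_ge0 := @mean_Phi_ge0 _ _ _ _ nodes_gt0 rate0_ge0 load_lt1 Y_ge0 O_ge0
  yellow_eq orange_eq load1.
have gw_stable delta (d0 : 0 <= delta) : stable A (gw delta) := greenwave_stable
  nodes_gt0 rate0_ge0 rate_ge0 load_lt1 YO_gt0 yellow_eq orange_eq rate_eq d0.
have gw_Phi1 delta (d0 : 0 <= delta) := mean_Phi1_gw nodes_gt0 rate0_ge0 rate_ge0
  load_lt1 Y_ge0 O_ge0 YO_gt0 yellow_eq orange_eq rate_eq d0.
have gw_Psi delta (d0 : 0 <= delta) := mean_Psi_gw nodes_gt0 rate0_ge0 rate_ge0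
  load_lt1 Y_ge0 O_ge0 YO_gt0 yellow_eq orange_eq rate_eq d0.
have gw_Phi delta (d0 : 0 <= delta) := mean_Phi_gw nodes_gt0 rate0_ge0 rate_ge0
  load_lt1 Y_ge0 O_ge0 YO_gt0 yellow_eq orange_eq rate_eq d0.
(* At [delta = 0] the policy is still stable and attains the bounds, so the infimum is a minimum and
   [gw 0] can serve as the competitor of an optimal policy. *)
have gw0_Phi1 : mean_Phi A (gw 0) 1 = Phi_bound%:E.
  by rewrite /gw gw_Phi1// !mul0r !addr0 mulr1.
have gw0_Psi n : is_node A n -> mean_Psi A (gw 0) n = Psi_bound%:E.
  by move=> nn; rewrite /gw gw_Psi// mulr0 mul0r !addr0 mulr1.
have limPhi1 : mean_Phi A (gw delta) 1 @[delta --> 0^'+] --> Phi_bound%:E.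
  have c := @cvg_quotient_at_right0 R l0 (1 - l0) l1 (Y + O)
    (2 * (1 - l0) * (1 - l0 - l1)) (l0 + l1).
  apply: cvg_trans (c _); last by rewrite !mulf_neq0// gt_eqF.
  apply: near_eq_cvg; near=> delta.
  by rewrite /gw gw_Phi1.
have limPsi n : is_node A n ->
    mean_Psi A (gw delta) n @[delta --> 0^'+] --> Psi_bound%:E.
  move=> nn; have c := @cvg_quotient_at_right0 R l1 (1 - l1) l0 (Y + O)
    (2 * (1 - l1) * (1 - l0 - l1)) (l0 + l1).
  apply: cvg_trans (c _); last by rewrite !mulf_neq0// gt_eqF.
  apply: near_eq_cvg; near=> delta.
  by rewrite /gw gw_Psi// -/l0 -/l1 [l0 * delta]mulrC addrAC.
have limPhi n : is_node A n -> (2 <= n)%N ->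
    mean_Phi A (gw delta) n @[delta --> 0^'+] --> 0%E.
  move=> nn n2; apply: cvg_near_cst; near=> delta.
  by rewrite /gw gw_Phi.
have node_cases n : is_node A n -> n = 1%N \/ (2 <= n)%N.
  by move=> /andP[]; case: n => [|[|n]]//; [left|right].
split.
- move=> delta d0; split; [exact: gw_stable|exact: gw_Phi1| |].
    by move=> n nn; exact: gw_Psi.
  by move=> n nn n2; exact: gw_Phi.
- move=> p st; have [lb eqlb] := lbPhi p st; split; first exact: lb.
    by move=> neq; rewrite ltNge; apply/negP => /eqlb[e _]; exact: neq e.
  move=> n nn; have [lb' eqlb'] := lbPsi p n st nn; split; first exact: lb'.
  by move=> neq; rewrite ltNge; apply/negP => /eqlb'[_ e]; exact: neq e.
- split; [exact: limPhi1|exact: limPsi| |].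
  + move=> q st n nn; split; last first.
      by rewrite (cvg_lim _ (limPsi n nn))//; case: (lbPsi q n st nn).
    have [->|n2] := node_cases n nn.
      by rewrite (cvg_lim _ limPhi1)//; case: (lbPhi q st).
    by rewrite (cvg_lim _ (limPhi n nn n2))//; exact: Phi_ge0.
  + split; first exact: gw_stable.
    move=> q st n nn; split; last by rewrite gw0_Psi//; case: (lbPsi q n st nn).
    have [->|n2] := node_cases n nn; first by rewrite gw0_Phi1; case: (lbPhi q st).
    by rewrite /gw gw_Phi//; exact: Phi_ge0.
- split.
  + by rewrite greenwave_greenE// addr0 mulr1.
  + by rewrite greenwave_redE// addr0 mulr1.
  move=> p [st opt].
  (* Comparison with [gw 0] yields three facts: the averages of the cross queues meet their bound,
     which fixes both means at every node; that of [Phi_1] is finite; and those of the other avenue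
     queues are at most 0. *)
  have opt0 := opt _ (gw_stable 0 (lexx 0)).
  have means n : is_node A n -> mean_green p n = G_opt /\ mean_red p n = R_opt.
    move=> nn; have [_ h] := opt0 n nn; rewrite gw0_Psi// in h.
    by have [_] := lbPsi p n st nn; apply.
  have meansG n nn := proj1 (means n nn); have meansR n nn := proj2 (means n nn).
  have W0 := YO_gt0.
  have UE : R_opt + (Y + O) + G_opt = (Y + O) / (1 - l0 - l1).
    by rewrite /R_opt /G_opt; field; rewrite gt_eqF.
  have critical : G_opt = l0 * (R_opt + (Y + O) + G_opt).
    by rewrite UE /G_opt mulrA.
  have U0 : 0 < R_opt + (Y + O) + G_opt by rewrite UE divr_gt0.
  have bnd : exists2 C : R, 0 <= C & (mean_Phi A p 1 < C%:E)%E.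
    (* Any finite bound would do; the absolute value and the 1 provide nonnegativity and
       strictness. *)
    exists (`|Phi_bound| + 1); first by rewrite addr_ge0.
    have [h _] := opt0 1%N node1; rewrite gw0_Phi1 in h.
    apply: (le_lt_trans h); rewrite lte_fin.
    by rewrite (le_lt_trans (ler_norm _))// ltrDl.
  have Phi0 n : is_node A n -> (2 <= n)%N -> (mean_Phi A p n <= 0)%E.
    by move=> nn n2; have [h _] := opt0 n nn; rewrite /gw gw_Phi in h.
  split; first exact: means.
  + by move=> n m nn mm; exact: (nongreen_coincide_node Y_ge0 O_ge0 yellow_eq
      orange_eq rate0_ge0 lt1 st meansG meansR critical U0 bnd Phi0 nn mm).
  + move=> T0 P T00 P0 per n m nn mm.
    exact: (nongreen_eq_periodic Y_ge0 O_ge0 yellow_eq orange_eq rate0_ge0 lt1 st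
      meansG meansR critical U0 bnd Phi0 nn mm T00 P0 per).
Unshelve. all: by end_near. Qed.
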